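(* Let $A\in\mathrm{SL}_d(\mathbb{A})$, let $\mathcal{W}\subset\mathbb{A}_f^d$ be a bounded Borel set with $m_f(\partial\mathcal{W})=0$, and let $\bm\alpha\in\mathbb{R}^d$. Define $F_{\mathcal{P},\bm\alpha}\colon(0,\infty)\to[0,1]$ by $$F_{\mathcal{P},\bm\alpha}(\xi)=\mu_{\mathrm{ASL}_d(\mathbb{Q})\backslash\mathrm{ASL}_d(\mathbb{A})}\big(\{g : \delta(\mathbb{Q})^dg\cap(\mathscr{C}_\xi\times\mathcal{W})=\emptyset\}\big)\quad\text{if }\bm\alpha\notin\mathbb{Q}^d,$$ $$F_{\mathcal{P},\bm\alpha}(\xi)=\mu_{\mathrm{SL}_d(\mathbb{Q})\backslash\mathrm{SL}_d(\mathbb{A})}\big(\{M : \delta(\mathbb{Q})^dM\cap(\mathscr{C}_\xi\times\mathcal{W}_{\bm\beta})=\emptyset\}\big)\quad\text{if }\bm\alpha\in\mathbb{Q}^d,$$ where in the second case $\bm\beta\in\delta(\mathbb{Q})^d$ is such that $\bm\alpha=\pi(\bm\beta)$ and $\mathcal{W}_{\bm\beta}=\mathcal{W}-\pi_{\mathrm{int}}(\bm\beta)A_f$. Then $F_{\mathcal{P},\bm\alpha}$ is continuous.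
   Context: $d\ge2$. $\mathbb{A}=\mathbb{R}\times\mathbb{A}_f$ is the ring of adeles of $\mathbb{Q}$, $\mathbb{A}^d=\mathbb{R}^d\times\mathbb{A}_f^d$, with canonical projections $\pi\colon\mathbb{A}^d\to\mathbb{R}^d$ and $\pi_{\mathrm{int}}\colon\mathbb{A}^d\to\mathbb{A}_f^d$; $A_f$ is the finite component of $A$. $\delta$ is the diagonal embedding of $\mathbb{Q}^d$ into $\mathbb{A}^d$. $\mathrm{ASL}_d(\mathbb{A})=\mathrm{SL}_d(\mathbb{A})\ltimes\mathbb{A}^d$ acts on row vectors on the right by $\bm x(M,\bm\zeta)=\bm xM+\bm\zeta$, and $\delta(\mathbb{Q})^dg$ is well defined for cosets modulo $\mathrm{ASL}_d(\mathbb{Q})$ (resp. $\mathrm{SL}_d(\mathbb{Q})$). $m_f$ is the Haar measure on $\mathbb{A}_f^d$. The measures $\mu$ are the invariant probability measures on the indicated quotients. For $\xi>0$, $\mathscr{C}_\xi=\{(x_1,\ldots,x_d)\in\mathbb{R}^d : 0<x_1<\xi,\ x_2^2+\cdots+x_d^2<1\}$, and $\mathscr{C}_\xi\times\mathcal{W}\subset\mathbb{R}^d\times\mathbb{A}_f^d=\mathbb{A}^d$. *)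

(* Defs.v *)
From HB Require Import structures.
From mathcomp Require Import all_boot all_order all_algebra.
From mathcomp Require Import all_classical all_reals all_analysis.
From mathcomp Require Import ring lra zify.

Set Implicit Arguments.
Unset Strict Implicit.
Unset Printing Implicit Defensive.
Import Order.TTheory GRing.Theory Num.Theory.
Import numFieldNormedType.Exports.

Local Open Scope classical_set_scope.
Local Open Scope ring_scope.

Definition primes_type := {p : nat | prime p}.
Definition prime_of (p : primes_type) : nat := val p.
Coercion prime_of : primes_type >-> nat.

Section PadicAbs.
Variable p : primes_type.

Definition padic_val (x : rat) : int :=
  (logn p `|numq x|)%:Z - (logn p `|denq x|)%:Z.

Definition padic_abs (x : rat) : rat :=
  if x == 0 then 0 else p%:R ^ (- padic_val x).

Lemma prime_gt1Q : 1 < p%:R :> rat.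
Proof. by rewrite ltr1n; apply/prime_gt1/(valP p). Qed.

Lemma prime_gt0Q : 0 < p%:R :> rat.
Proof. exact: lt_trans ltr01 prime_gt1Q. Qed.

Lemma padic_abs0 : padic_abs 0 = 0.
Proof. by rewrite /padic_abs eqxx. Qed.

Lemma padic_abs_gt0 x : x != 0 -> 0 < padic_abs x.
Proof. by move=> /negPf x0; rewrite /padic_abs x0 exprz_gt0 // prime_gt0Q. Qed.

Lemma padic_abs_ge0 x : 0 <= padic_abs x.
Proof.
by have [->|/padic_abs_gt0/ltW //] := eqVneq x 0; rewrite padic_abs0.
Qed.

Lemma padic_val_frac (a b : int) : a != 0 -> b != 0 ->
  padic_val (a%:~R / b%:~R) = (logn p `|a|)%:Z - (logn p `|b|)%:Z.
Proof.
move=> a0 b0; rewrite /padic_val; set x : rat := _ / _.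
have x0 : x != 0 by rewrite mulf_neq0 ?invr_eq0 ?intr_eq0.
have E : numq x * b = a * denq x.
  apply: (@intr_inj rat); rewrite !rmorphM /= numqE mulrAC; congr (_ * _).
  by rewrite divfK // intr_eq0.
have := congr1 (fun z : int => logn p `|z|%N) E.
rewrite !abszM !lognM ?absz_gt0 ?numq_eq0 ?denq_eq0 //; lia.
Qed.

Lemma padic_valM x y : x != 0 -> y != 0 ->
  padic_val (x * y) = padic_val x + padic_val y.
Proof.
move=> x0 y0; have -> : x * y = (numq x * numq y)%:~R / (denq x * denq y)%:~R.
  by rewrite -{1}[x]divq_num_den -{1}[y]divq_num_den !rmorphM/= mulf_div.
rewrite padic_val_frac ?mulf_neq0 ?numq_eq0 ?denq_eq0 //.
rewrite !abszM !lognM ?absz_gt0 ?numq_eq0 ?denq_eq0 // /padic_val; lia.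
Qed.

Lemma padic_absM x y : padic_abs (x * y) = padic_abs x * padic_abs y.
Proof.
have [->|x0] := eqVneq x 0; first by rewrite mul0r padic_abs0 mul0r.
have [->|y0] := eqVneq y 0; first by rewrite mulr0 padic_abs0 mulr0.
rewrite /padic_abs mulf_eq0 (negPf x0) (negPf y0) /= padic_valM // opprD.
by rewrite expfzDr // gt_eqF // prime_gt0Q.
Qed.

Lemma padic_abs1 : padic_abs 1 = 1.
Proof. by rewrite /padic_abs oner_eq0 /padic_val subrr. Qed.

Lemma padic_absN x : padic_abs (- x) = padic_abs x.
Proof. by rewrite /padic_abs oppr_eq0 /padic_val numqN denqN abszN. Qed.

Lemma padic_abs_le1 x : x != 0 -> (padic_abs x <= 1) = (0 <= padic_val x).
Proof.
move=> /negPf x0; rewrite /padic_abs x0 -[X in _ <= X](expr0z p%:R).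
by rewrite ler_eXz2l ?prime_gt1Q // oppr_le0.
Qed.

Lemma padic_abs_add1 z : padic_abs z <= 1 -> padic_abs (1 + z) <= 1.
Proof.
have [->|z0] := eqVneq z 0; first by rewrite addr0 padic_abs1.
have [->|z1] := eqVneq (1 + z) 0; first by rewrite padic_abs0.
rewrite !padic_abs_le1 // => vz.
have E : 1 + z = (denq z + numq z)%:~R / (denq z)%:~R.
  rewrite rmorphD /= mulrDl divff ?intr_eq0 ?denq_eq0 // divq_num_den //.
have dz0 : logn p `|denq z| = 0%N.
  apply/eqP; rewrite lognE; case: ifP => // /and3P[pp _ pd].
  have : (0 < logn p `|numq z|)%N.
    move: vz; rewrite /padic_val; suff : (0 < logn p `|denq z|)%N by lia.
    by rewrite logn_gt0 mem_primes pp absz_gt0 denq_eq0.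
  rewrite logn_gt0 mem_primes => /and3P[_ _ pn].
  have := coprime_num_den z; rewrite /coprime => /eqP g1.
  have : (p %| gcdn `|numq z| `|denq z|)%N by rewrite dvdn_gcd pn pd.
  by rewrite g1 dvdn1 => /eqP p1; move: pp; rewrite p1.
rewrite E padic_val_frac ?dz0 ?subr0 ?denq_eq0 //.
by move: z1; rewrite E; apply: contraNneq => ->; rewrite mul0r.
Qed.

Lemma padic_absD x y :
  padic_abs (x + y) <= Num.max (padic_abs x) (padic_abs y).
Proof.
wlog le : x y / padic_abs y <= padic_abs x => [H|].
  have /orP[] := le_total (padic_abs y) (padic_abs x); first exact: H.
  by rewrite addrC maxC; apply: H.
rewrite (max_idPl le); have [x0|x0] := eqVneq x 0.
  by rewrite x0 add0r; move: le; rewrite x0.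
have -> : x + y = x * (1 + y / x) by field.
rewrite padic_absM ler_piMr ?padic_abs_ge0 // padic_abs_add1 //.
rewrite -(ler_pM2l (padic_abs_gt0 x0)) -padic_absM mulr1.
by rewrite mulrC divfK.
Qed.

Lemma padic_absD_le x y e :
  padic_abs x <= e -> padic_abs y <= e -> padic_abs (x + y) <= e.
Proof. by move=> xe ye; apply: le_trans (padic_absD _ _) _; rewrite ge_max xe. Qed.

Lemma padic_absD_lt x y e :
  padic_abs x < e -> padic_abs y < e -> padic_abs (x + y) < e.
Proof. by move=> xe ye; apply: le_lt_trans (padic_absD _ _) _; rewrite gt_max xe. Qed.

Lemma padic_abs_dist x y : `|padic_abs x - padic_abs y| <= padic_abs (x - y).
Proof.
wlog le : x y / padic_abs y <= padic_abs x => [H|].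
  have /orP[] := le_total (padic_abs y) (padic_abs x); first exact: H.
  by rewrite distrC -(padic_absN (x - y)) opprB; exact: H.
rewrite ger0_norm ?subr_ge0 //.
have := padic_absD (x - y) y; rewrite subrK le_max.
case/orP => h; first by apply: le_trans h; rewrite gerBl padic_abs_ge0.
by apply: le_trans (padic_abs_ge0 _); rewrite subr_le0.
Qed.

End PadicAbs.

Definition padic_cauchy (p : primes_type) : {pred nat -> rat} :=
  [pred u | `[< forall e : rat, 0 < e -> exists N, forall m n : nat,
     (N <= m)%N -> (N <= n)%N -> padic_abs p (u m - u n) < e >]].

Section Cauchy.
Variable p : primes_type.

Lemma padic_cauchy_bounded u : u \in padic_cauchy p ->
  exists2 B, 0 < B & exists N, forall n, (N <= n)%N -> padic_abs p (u n) <= B.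
Proof.
move=> /asboolP /(_ 1 ltr01)[N H].
exists (Num.max 1 (padic_abs p (u N))); first by rewrite lt_max ltr01.
exists N => n Nn; rewrite -[u n](subrK (u N)); apply: padic_absD_le.
  by rewrite le_max ltW // H.
by rewrite le_max lexx orbT.
Qed.

Lemma padic_cauchy_subring : subring_closed (padic_cauchy p).
Proof.
split.
- by apply/asboolP => e e0; exists 0%N => m n _ _; rewrite subrr padic_abs0.
- move=> u v /asboolP cu /asboolP cv; apply/asboolP => e e0.
  have [N1 H1] := cu e e0; have [N2 H2] := cv e e0.
  exists (maxn N1 N2) => m n; rewrite !geq_max => /andP[m1 m2] /andP[n1 n2].
  have -> : (u - v) m - (u - v) n = (u m - u n) + - (v m - v n).
    by change (u m - v m - (u n - v n) = u m - u n + - (v m - v n)); ring.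
  by apply: padic_absD_lt; rewrite ?padic_absN; [exact: H1|exact: H2].
- move=> u v cu cv; have [B B0 [Nu Hu]] := padic_cauchy_bounded cu.
  have [C C0 [Nv Hv]] := padic_cauchy_bounded cv.
  move: cu cv => /asboolP cu /asboolP cv; apply/asboolP => e e0.
  have [N1 H1] := cu (e / C) (divr_gt0 e0 C0).
  have [N2 H2] := cv (e / B) (divr_gt0 e0 B0).
  exists (maxn (maxn N1 N2) (maxn Nu Nv)) => m n.
  rewrite !geq_max => /andP[/andP[m1 m2] /andP[m3 m4]].
  move=> /andP[/andP[n1 n2] /andP[n3 n4]].
  have -> : (u * v) m - (u * v) n = u m * (v m - v n) + (u m - u n) * v n.
    change (u m * v m - u n * v n = u m * (v m - v n) + (u m - u n) * v n).
    by ring.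
  apply: padic_absD_lt; rewrite padic_absM.
    apply: le_lt_trans (ler_wpM2r (padic_abs_ge0 _ _) (Hu m m3)) _.
    by rewrite mulrC -ltr_pdivlMr // H2.
  apply: le_lt_trans (ler_wpM2l (padic_abs_ge0 _ _) (Hv n n4)) _.
  by rewrite -ltr_pdivlMr // H1.
Qed.

HB.instance Definition _ :=
  GRing.isSubringClosed.Build (nat -> rat) (padic_cauchy p) padic_cauchy_subring.

Record padic_seq := PadicSeq {
  padic_seq_val :> nat -> rat;
  padic_seqP : padic_seq_val \in padic_cauchy p }.

HB.instance Definition _ := [isSub for padic_seq_val].
HB.instance Definition _ := [Choice of padic_seq by <:].
HB.instance Definition _ := [SubChoice_isSubComNzRing of padic_seq by <:].

Definition padic_null : {pred padic_seq} :=
  [pred u : padic_seq | `[< forall e : rat, 0 < e -> exists N, forall n : nat,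
     (N <= n)%N -> padic_abs p (u n) < e >]].

Lemma padic_null_ideal : idealr_closed padic_null.
Proof.
split.
- by apply/asboolP => e e0; exists 0%N => n _; rewrite padic_abs0.
- apply/asboolP => /(_ 1 ltr01)[N /(_ N (leqnn _))].
  by rewrite /= padic_abs1 ltxx.
- move=> a u v /asboolP nu /asboolP nv; apply/asboolP => e e0.
  have [B B0 [Na Ha]] := padic_cauchy_bounded (padic_seqP a).
  have [N1 H1] := nu (e / B) (divr_gt0 e0 B0); have [N2 H2] := nv e e0.
  exists (maxn Na (maxn N1 N2)) => n.
  rewrite !geq_max => /andP[n1 /andP[n2 n3]].
  apply: padic_absD_lt; last exact: H2.
  rewrite padic_absM.
  apply: le_lt_trans (ler_wpM2r (padic_abs_ge0 _ _) (Ha n n1)) _.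
  by rewrite mulrC -ltr_pdivlMr // H1.
Qed.

HB.instance Definition _ := isIdealr.Build padic_seq padic_null padic_null_ideal.

Definition Qp := {ideal_quot padic_null}.
HB.instance Definition _ := GRing.ComNzRing.on Qp.
HB.instance Definition _ := EqQuotient.on Qp.

End Cauchy.

Section QpTopology.
Variable p : primes_type.
Implicit Types x y : Qp p.
Local Open Scope quotient_scope.

(* The limit, for the archimedean topology of rat, of |x_n|_p along a Cauchy
   sequence representing x; it exists in rat since this sequence is eventually
   constant or tends to 0. *)
Definition Qp_abs x : rat :=
  lim ((padic_abs p (repr x n) : rat^o) @[n --> \oo]).

Lemma padic_abs_seq_cvg (u : padic_seq p) :
  cvg ((padic_abs p (u n) : rat^o) @[n --> \oo]).
Proof.
have [nu|nu] := boolP (u \in @padic_null p).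
  apply: (cvgP (0 : rat^o)); apply/cvgrPdist_lt => e e0.
  move: nu => /asboolP/(_ e e0)[N H].
  exists N => // n /= Nn; rewrite sub0r normrN ger0_norm ?padic_abs_ge0 //.
  exact: H.
move: nu => /asboolP/existsNP[e] /not_implyP[e0 /forallNP H].
have [N HN] := asboolW (padic_seqP u) e e0.
have /existsNP[n0 /not_implyP[Nn0 /negP]] := H N; rewrite -leNgt => en0.
apply: (cvgP (padic_abs p (u n0) : rat^o)); apply: cvg_near_cst.
exists N => // m /= Nm; apply/eqP; rewrite eq_le.
have d := HN m n0 Nm Nn0; apply/andP; split.
  rewrite -{1}[u m](subrK (u n0)); apply: padic_absD_le => //.
  exact/ltW/(lt_le_trans d).
rewrite leNgt; apply/negP => lt.
suff : padic_abs p (u n0) < padic_abs p (u n0) by rewrite ltxx.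
have -> : padic_abs p (u n0) = padic_abs p (u m + (u n0 - u m)) by rewrite subrKC.
apply: padic_absD_lt; first by rewrite subrKC.
by rewrite subrKC -padic_absN opprB; exact: lt_le_trans d en0.
Qed.

Lemma Qp_abs_cvg (u : padic_seq p) :
  (padic_abs p (u n) : rat^o) @[n --> \oo] --> (Qp_abs (\pi_(Qp p) u) : rat^o).
Proof.
set r := repr (\pi_(Qp p) u : Qp p).
have nu : r - u \in @padic_null p.
  by rewrite Quotient.idealrBE; apply/eqP; exact: reprK.
have cr : (padic_abs p (r n) : rat^o) @[n --> \oo] --> (Qp_abs (\pi_(Qp p) u) : rat^o).
  exact: padic_abs_seq_cvg.
apply: cvg_sub0 cr; apply/cvgrPdist_lt => e e0.
move: nu => /asboolP/(_ e e0)[N H]; exists N => // n /= Nn.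
rewrite sub0r normrN /=; apply: le_lt_trans (padic_abs_dist _ _ _) _.
by rewrite -padic_absN opprB; exact: H.
Qed.

Lemma QpP x : exists u : padic_seq p, x = \pi u.
Proof. by exists (repr x); rewrite reprK. Qed.

Lemma Qp_abs_lim (u : padic_seq p) (l : rat) :
  (padic_abs p (u n) : rat^o) @[n --> \oo] --> (l : rat^o) ->
  Qp_abs (\pi_(Qp p) u) = l.
Proof.
move=> h; apply: (@cvg_unique rat^o (@norm_hausdorff rat rat^o)
  ((padic_abs p (u n) : rat^o) @[n --> \oo])) => //; exact: Qp_abs_cvg.
Qed.

Lemma Qp_absN x : Qp_abs (- x) = Qp_abs x.
Proof.
have [u ->] := QpP x; rewrite -rmorphN; apply: Qp_abs_lim.
apply: cvg_trans (@Qp_abs_cvg u); apply: near_eq_cvg; near=> n.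
by rewrite /= padic_absN.
Unshelve. all: by end_near. Qed.

Lemma Qp_abs_ge0 x : 0 <= Qp_abs x.
Proof.
have [u ->] := QpP x; rewrite leNgt; apply/negP => lt0.
have Hu : \forall n \near \oo, padic_abs p (u n) < 0.
  exact: (@cvgr_lt rat _ _ _ _ _ (@Qp_abs_cvg u)).
by have [n] := filter_ex Hu; rewrite ltNge padic_abs_ge0.
Qed.

Lemma Qp_absM x y : Qp_abs (x * y) = Qp_abs x * Qp_abs y.
Proof.
have [u ->] := QpP x; have [v ->] := QpP y; rewrite -rmorphM.
apply: Qp_abs_lim.
apply: cvg_trans (@cvgM rat _ _ _ _ _ _ _ (@Qp_abs_cvg u) (@Qp_abs_cvg v)).
by apply: near_eq_cvg; near=> n; rewrite /= padic_absM.
Unshelve. all: by end_near. Qed.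

Lemma Qp_absD x y : Qp_abs (x + y) <= Num.max (Qp_abs x) (Qp_abs y).
Proof.
have [u ->] := QpP x; have [v ->] := QpP y; rewrite -rmorphD.
set a := Qp_abs (\pi_(Qp p) u); set b := Qp_abs (\pi_(Qp p) v).
set c := Qp_abs _; rewrite leNgt; apply/negP => lt.
have [t /andP[lt1 lt2]] : exists t, Num.max a b < t < c.
  by exists ((Num.max a b + c) / 2); rewrite midf_lt // midf_lt.
move: lt1; rewrite gt_max => /andP[at_ bt].
have Hu : \forall n \near \oo, padic_abs p (u n) < t.
  exact: (@cvgr_lt rat _ _ _ _ _ (@Qp_abs_cvg u)).
have Hv : \forall n \near \oo, padic_abs p (v n) < t.
  exact: (@cvgr_lt rat _ _ _ _ _ (@Qp_abs_cvg v)).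
have Hw : \forall n \near \oo, t < padic_abs p (u n + v n).
  exact: (@cvgr_gt rat _ _ _ _ _ (@Qp_abs_cvg (u + v))).
have [n [[h1 h2] h3]] := filter_ex (filterI (filterI Hu Hv) Hw).
suff : t < t by rewrite ltxx.
apply: lt_trans h3 _; exact: padic_absD_lt.
Qed.

Lemma Qp_abs_const (q : rat) (h : cst q \in padic_cauchy p) :
  Qp_abs (\pi_(Qp p) (PadicSeq h)) = padic_abs p q.
Proof. by apply: Qp_abs_lim; apply: cvg_near_cst; exists 0%N. Qed.

Definition Qp_open : set_system (Qp p) := [set U | forall x, U x ->
  exists2 e : rat, 0 < e & forall y, Qp_abs (y - x) < e -> U y].

Lemma Qp_openT : Qp_open setT.
Proof. by move=> x _; exists 1. Qed.

Lemma Qp_openI : setI_closed Qp_open.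
Proof.
move=> U V oU oV x [Ux Vx]; have [e e0 He] := oU x Ux.
have [f f0 Hf] := oV x Vx; exists (Num.min e f); first by rewrite lt_min e0.
by move=> y; rewrite lt_min => /andP[/He ? /Hf ?].
Qed.

Lemma Qp_open_bigU (I : Type) (f : I -> set (Qp p)) :
  (forall i, Qp_open (f i)) -> Qp_open (\bigcup_i f i).
Proof.
move=> of_ x [i _ fx]; have [e e0 He] := of_ i x fx.
by exists e => // y /He fy; exists i.
Qed.

HB.instance Definition _ :=
  isOpenTopological.Build (Qp p) Qp_openT Qp_openI Qp_open_bigU.

Definition Zp : set (Qp p) := [set x | Qp_abs x <= 1].

Lemma Zp_open : open Zp.
Proof.
move=> x Zx; exists 1 => // y yx; rewrite /Zp /= -[y](subrK x).
by apply: le_trans (Qp_absD _ _) _; rewrite ge_max (ltW yx).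
Qed.

Lemma ratQp_subproof (q : rat) : cst q \in padic_cauchy p.
Proof. by apply/asboolP => e e0; exists 0%N => m n _ _; rewrite subrr padic_abs0. Qed.

Definition ratQp (q : rat) : Qp p := \pi_(Qp p) (PadicSeq (ratQp_subproof q)).

Lemma ratQp_zmod : zmod_morphism ratQp.
Proof. by move=> a b; rewrite /ratQp -rmorphB; congr (\pi_(Qp p) _); apply: val_inj. Qed.

Lemma ratQp_monoid : monoid_morphism ratQp.
Proof.
split; first by rewrite /ratQp -(rmorph1 \pi_(Qp p)); congr (\pi_(Qp p) _); apply: val_inj.
by move=> a b; rewrite /ratQp -rmorphM; congr (\pi_(Qp p) _); apply: val_inj.
Qed.

HB.instance Definition _ := GRing.isZmodMorphism.Build rat (Qp p) ratQp ratQp_zmod.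
HB.instance Definition _ := GRing.isMonoidMorphism.Build rat (Qp p) ratQp ratQp_monoid.

Lemma Qp_abs_rat q : Qp_abs (ratQp q) = padic_abs p q.
Proof. exact: Qp_abs_const. Qed.

Lemma Zp_subring : subring_closed [pred x | `[< Zp x >]].
Proof.
split.
- by apply/asboolP; rewrite /Zp /= -(rmorph1 ratQp) Qp_abs_rat padic_abs1.
- move=> x y /asboolP Zx /asboolP Zy; apply/asboolP.
  by apply: le_trans (Qp_absD _ _) _; rewrite Qp_absN ge_max; apply/andP.
- move=> x y /asboolP Zx /asboolP Zy; apply/asboolP.
  by rewrite /Zp/= Qp_absM mulr_ile1 ?Qp_abs_ge0.
Qed.

End QpTopology.

Definition prodQp := forall p : primes_type, Qp p.

Section ProdQp.
Implicit Types x y z : prodQp.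

HB.instance Definition _ := Choice.copy prodQp (forall p : primes_type, Qp p).

Definition prodQp_add x y : prodQp := fun p => x p + y p.
Definition prodQp_opp x : prodQp := fun p => - x p.
Definition prodQp_mul x y : prodQp := fun p => x p * y p.

Lemma prodQp_addA : associative prodQp_add.
Proof. by move=> x y z; apply: functional_extensionality_dep => p; exact: addrA. Qed.
Lemma prodQp_addC : commutative prodQp_add.
Proof. by move=> x y; apply: functional_extensionality_dep => p; exact: addrC. Qed.
Lemma prodQp_add0 : left_id (fun=> 0 : Qp _) prodQp_add.
Proof. by move=> x; apply: functional_extensionality_dep => p; exact: add0r. Qed.
Lemma prodQp_addN : left_inverse (fun=> 0 : Qp _) prodQp_opp prodQp_add.
Proof. by move=> x; apply: functional_extensionality_dep => p; exact: addNr. Qed.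
HB.instance Definition _ := GRing.isZmodule.Build prodQp
  prodQp_addA prodQp_addC prodQp_add0 prodQp_addN.

Lemma prodQp_mulA : associative prodQp_mul.
Proof. by move=> x y z; apply: functional_extensionality_dep => p; exact: mulrA. Qed.
Lemma prodQp_mulC : commutative prodQp_mul.
Proof. by move=> x y; apply: functional_extensionality_dep => p; exact: mulrC. Qed.
Lemma prodQp_mul1 : left_id (fun=> 1 : Qp _) prodQp_mul.
Proof. by move=> x; apply: functional_extensionality_dep => p; exact: mul1r. Qed.
Lemma prodQp_mulDl : left_distributive prodQp_mul prodQp_add.
Proof. by move=> x y z; apply: functional_extensionality_dep => p; exact: mulrDl. Qed.
Lemma prodQp_1neq0 : (fun=> 1 : Qp _) != (0 : prodQp).
Proof.
by apply/eqP => /(congr1 (fun f : prodQp => f (exist _ 2%N isT)))/eqP; rewrite oner_eq0.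
Qed.
HB.instance Definition _ := GRing.Zmodule_isComNzRing.Build prodQp
  prodQp_mulA prodQp_mulC prodQp_mul1 prodQp_mulDl prodQp_1neq0.

End ProdQp.

Definition restricted : {pred prodQp} :=
  [pred x | `[< finite_set [set p | ~ Zp (x p)] >]].

Lemma restricted_subring : subring_closed restricted.
Proof.
split.
- apply/asboolP; rewrite (_ : [set p | _] = set0) //.
  apply/seteqP; split => // p /=; apply.
  by have [/asboolP] := Zp_subring p.
- move=> x y /asboolP fx /asboolP fy; apply/asboolP.
  apply: sub_finite_set
    (_ : _ `<=` [set p | ~ Zp (x p)] `|` [set p | ~ Zp (y p)]) _;
    last by rewrite finite_setU.
  move=> p /= nz; apply: contrapT => /not_orP[/contrapT h1 /contrapT h2]; apply: nz.
  by have [_ + _] := Zp_subring p => /(_ (x p) (y p)) h; apply/asboolP/h; apply/asboolP.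
- move=> x y /asboolP fx /asboolP fy; apply/asboolP.
  apply: sub_finite_set
    (_ : _ `<=` [set p | ~ Zp (x p)] `|` [set p | ~ Zp (y p)]) _;
    last by rewrite finite_setU.
  move=> p /= nz; apply: contrapT => /not_orP[/contrapT h1 /contrapT h2]; apply: nz.
  by have [_ _ +] := Zp_subring p => /(_ (x p) (y p)) h; apply/asboolP/h; apply/asboolP.
Qed.

HB.instance Definition _ :=
  GRing.isSubringClosed.Build prodQp restricted restricted_subring.

Record fadele := FAdele {
  fadele_val : prodQp;
  fadeleP : fadele_val \in restricted }.

HB.instance Definition _ := [isSub for fadele_val].
HB.instance Definition _ := [Choice of fadele by <:].
HB.instance Definition _ := [SubChoice_isSubComNzRing of fadele by <:].
HB.instance Definition _ := isPointed.Build fadele 0.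

(* Restricted product topology: the boxes of open V p, with V p = Zp for almost
   all p, form a base. *)
Definition fadele_open : set_system fadele := [set U | forall x, U x ->
  exists V : forall p, set (Qp p),
    [/\ forall p, open (V p), finite_set [set p | V p != @Zp p],
        forall p, V p (fadele_val x p) &
        forall y, (forall p, V p (fadele_val y p)) -> U y]].

Lemma fadele_openT : fadele_open setT.
Proof.
move=> x _; 
exists (fun p => if pselect (Zp (fadele_val x p)) then @Zp p else setT).
split => //.
- by move=> p; case: pselect => ?; [exact: Zp_open|exact: openT].
- apply: sub_finite_set (asboolW (fadeleP x)) => p /=.
  by case: pselect => // ?; rewrite eqxx.
- by move=> p; case: pselect.
Qed.

Lemma fadele_openI : setI_closed fadele_open.
Proof.
move=> U1 U2 o1 o2 x [x1 x2]; have [V1 [oV1 f1 V1x V1U]] := o1 x x1.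
have [V2 [oV2 f2 V2x V2U]] := o2 x x2.
exists (fun p => V1 p `&` V2 p); split => //.
- by move=> p; exact: openI.
- apply: sub_finite_set
    (_ : _ `<=` [set p | V1 p != @Zp p] `|` [set p | V2 p != @Zp p]) _;
    last by rewrite finite_setU.
  move=> p /=; have [->|] := eqVneq (V1 p) (@Zp p); last by left.
  have [->|] := eqVneq (V2 p) (@Zp p); last by right.
  by rewrite setIid eqxx.
- by move=> y Vy; split; [apply: V1U => p|apply: V2U => p]; have [] := Vy p.
Qed.

Lemma fadele_open_bigU (I : Type) (f : I -> set fadele) :
  (forall i, fadele_open (f i)) -> fadele_open (\bigcup_i f i).
Proof.
move=> of_ x [i _ fx]; have [V [oV fV Vx VU]] := of_ i x fx.
by exists V; split => // y /VU ?; exists i.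
Qed.

HB.instance Definition _ :=
  isOpenTopological.Build fadele fadele_openT fadele_openI fadele_open_bigU.

Lemma ratfadele_subproof (q : rat) : (fun p => ratQp p q) \in restricted.
Proof.
apply/asboolP.
have fin : finite_set [set p : primes_type | [set` primes `|denq q|] (p : nat)].
  by apply: finite_preimage => // x y _ _; exact: val_inj.
apply: sub_finite_set fin => p /=; apply: contra_notP => /negP pq.
rewrite /Zp /= Qp_abs_rat; have [->|q0] := eqVneq q 0; first by rewrite padic_abs0.
rewrite padic_abs_le1 // /padic_val.
suff -> : logn p `|denq q| = 0%N by rewrite subr0.
by apply/eqP; rewrite -leqn0 leqNgt logn_gt0.
Qed.

Definition ratfadele (q : rat) : fadele := FAdele (ratfadele_subproof q).

Lemma ratfadele_zmod : zmod_morphism ratfadele.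
Proof.
move=> a b; apply: val_inj; apply: functional_extensionality_dep => p.
exact: (raddfB (ratQp p)).
Qed.

Lemma ratfadele_monoid : monoid_morphism ratfadele.
Proof.
split=> [|a b]; apply: val_inj; apply: functional_extensionality_dep => p.
  exact: (rmorph1 (ratQp p)).
exact: (rmorphM (ratQp p)).
Qed.

HB.instance Definition _ :=
  GRing.isZmodMorphism.Build rat fadele ratfadele ratfadele_zmod.
HB.instance Definition _ :=
  GRing.isMonoidMorphism.Build rat fadele ratfadele ratfadele_monoid.

Definition adele (R : realType) : Type := (R * fadele)%type.

HB.instance Definition _ (R : realType) := GRing.ComNzRing.copy (adele R) (R * fadele)%type.
HB.instance Definition _ (R : realType) := Topological.copy (adele R) (R * fadele)%type.
HB.instance Definition _ (R : realType) := Pointed.copy (adele R) (R * fadele)%type.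

Definition delta (R : realType) (q : rat) : adele R := (ratr q, ratfadele q).

Section Delta.
Variable R : realType.
Lemma delta_zmod : zmod_morphism (@delta R).
Proof. by move=> a b; rewrite /delta !rmorphB. Qed.
Lemma delta_monoid : monoid_morphism (@delta R).
Proof. by split=> [|a b]; rewrite /delta ?rmorph1 ?rmorphM. Qed.
HB.instance Definition _ :=
  GRing.isZmodMorphism.Build rat (adele R) (@delta R) delta_zmod.
HB.instance Definition _ :=
  GRing.isMonoidMorphism.Build rat (adele R) (@delta R) delta_monoid.
End Delta.

Section SL.
Variables (K : comPzRingType) (d : nat).

Record SL := MkSL { SL_mx :> 'M[K]_d; SLP : \det SL_mx == 1 }.

HB.instance Definition _ := [isSub for SL_mx].
HB.instance Definition _ := [Choice of SL by <:].

Lemma SL_one_subproof : \det (1%:M : 'M[K]_d) == 1.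
Proof. by rewrite det1. Qed.
Lemma SL_mul_subproof (M N : SL) : \det (M *m N) == 1.
Proof. by rewrite det_mulmx (eqP (SLP M)) (eqP (SLP N)) mulr1. Qed.
Lemma SL_inv_subproof (M : SL) : \det (\adj M) == 1.
Proof.
have := congr1 determinant (mul_mx_adj M).
by rewrite det_mulmx (eqP (SLP M)) mul1r det1 => ->.
Qed.

Definition SL_one : SL := MkSL SL_one_subproof.
Definition SL_mul (M N : SL) : SL := MkSL (SL_mul_subproof M N).
Definition SL_inv (M : SL) : SL := MkSL (SL_inv_subproof M).

Lemma SL_mulA : associative SL_mul.
Proof. by move=> M N P; apply: val_inj; exact: mulmxA. Qed.
Lemma SL_mul1 : left_id SL_one SL_mul.
Proof. by move=> M; apply: val_inj; exact: mul1mx. Qed.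
Lemma SL_1mul : right_id SL_one SL_mul.
Proof. by move=> M; apply: val_inj; exact: mulmx1. Qed.
Lemma SL_mulV : left_inverse SL_one SL_inv SL_mul.
Proof. by move=> M; apply: val_inj; rewrite /= mul_adj_mx (eqP (SLP M)). Qed.
Lemma SL_Vmul : right_inverse SL_one SL_inv SL_mul.
Proof. by move=> M; apply: val_inj; rewrite /= mul_mx_adj (eqP (SLP M)). Qed.

HB.instance Definition _ := isGroup.Build SL
  SL_mulA SL_mul1 SL_1mul SL_mulV SL_Vmul.

Record ASL := MkASL { ASL_lin : SL; ASL_tr : 'rV[K]_d }.

Definition ASL_pair (g : ASL) := (ASL_lin g, ASL_tr g).
Definition pair_ASL (g : SL * 'rV[K]_d) := MkASL g.1 g.2.
Lemma ASL_pairK : cancel ASL_pair pair_ASL.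
Proof. by case. Qed.
HB.instance Definition _ := Equality.copy ASL (can_type ASL_pairK).
HB.instance Definition _ := Choice.copy ASL (can_type ASL_pairK).

Definition ASL_one : ASL := MkASL 1%g 0.
Definition ASL_mul (g h : ASL) : ASL :=
  MkASL (ASL_lin g * ASL_lin h)%g (ASL_tr g *m ASL_lin h + ASL_tr h).
Definition ASL_inv (g : ASL) : ASL :=
  MkASL (ASL_lin g)^-1%g (- (ASL_tr g *m (ASL_lin g)^-1%g)).

Lemma ASL_mulA : associative ASL_mul.
Proof.
move=> g h k; congr MkASL; first exact: mulgA.
by rewrite mulmxDl -mulmxA addrA.
Qed.
Lemma ASL_mul1 : left_id ASL_one ASL_mul.
Proof. by case=> M z; congr MkASL; [exact: mul1g | rewrite mul0mx add0r]. Qed.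
Lemma ASL_1mul : right_id ASL_one ASL_mul.
Proof. by case=> M z; congr MkASL; [exact: mulg1 | rewrite mulmx1 addr0]. Qed.
Lemma ASL_mulV : left_inverse ASL_one ASL_inv ASL_mul.
Proof.
case=> M z; congr MkASL; first exact: mulVg.
by rewrite /= mulNmx -mulmxA mul_adj_mx (eqP (SLP M)) mulmx1 addNr.
Qed.
Lemma ASL_Vmul : right_inverse ASL_one ASL_inv ASL_mul.
Proof. by case=> M z; congr MkASL; [exact: mulgV | rewrite /= addrN]. Qed.

HB.instance Definition _ := isGroup.Build ASL
  ASL_mulA ASL_mul1 ASL_1mul ASL_mulV ASL_Vmul.

Definition ASL_act (x : 'rV[K]_d) (g : ASL) : 'rV[K]_d := x *m ASL_lin g + ASL_tr g.

End SL.
Arguments ASL_act {K d}.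

Section SLmap.
Variables (K L : comPzRingType) (f : {rmorphism K -> L}) (d : nat).

Lemma SL_map_subproof (M : SL K d) : \det (map_mx f M) == 1.
Proof. by rewrite det_map_mx (eqP (SLP M)) rmorph1. Qed.

Definition SL_map (M : SL K d) : SL L d := MkSL (SL_map_subproof M).

Definition ASL_map (g : ASL K d) : ASL L d :=
  MkASL (SL_map (ASL_lin g)) (map_mx f (ASL_tr g)).

Lemma SL_map_morphism :
  (SL_map 1 = 1)%g * {morph SL_map : M N / (M * N)%g}.
Proof.
by split=> [|M N]; apply: val_inj; [exact: map_mx1 | exact: map_mxM].
Qed.

HB.instance Definition _ :=
  isUMagmaMorphism.Build (SL K d) (SL L d) SL_map SL_map_morphism.

Lemma ASL_map_morphism :
  (ASL_map 1 = 1)%g * {morph ASL_map : g h / (g * h)%g}.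
Proof.
split=> [|g h]; congr MkASL.
- exact: gmulf1.
- exact: map_mx0.
- exact: gmulfM.
- by rewrite /= map_mxD map_mxM.
Qed.

HB.instance Definition _ :=
  isUMagmaMorphism.Build (ASL K d) (ASL L d) ASL_map ASL_map_morphism.

End SLmap.

Section LeftQuotient.
Variables (H G : groupType) (f : UMagmaMorphism.type H G).

(* Cosets f(H) g, i.e. the quotient f(H)\G. *)
Definition lquot_rel (g h : G) : bool := `[< exists c : H, h = (f c * g)%g >].

Lemma lquot_equiv : equiv_class_of lquot_rel.
Proof.
split.
- by move=> g; apply/asboolP; exists 1%g; rewrite gmulf1 mul1g.
- suff sub g h : lquot_rel g h -> lquot_rel h g by move=> g h; apply/idP/idP => /sub.
  move=> /asboolP[c ->]; apply/asboolP; exists (c^-1)%g.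
  by rewrite mulgA -gmulfM mulVg gmulf1 mul1g.
- move=> h g k /asboolP[c ->] /asboolP[e ->]; apply/asboolP.
  by exists (e * c)%g; rewrite gmulfM mulgA.
Qed.

Canonical lquot_equivRel := EquivRelPack lquot_equiv.

Definition lquot := {eq_quot lquot_rel}%qT.
HB.instance Definition _ := EqQuotient.on lquot.
HB.instance Definition _ := Choice.on lquot.

Definition lquot_mulr (g : G) (x : lquot) : lquot :=
  \pi_(lquot)%qT (repr x * g)%g.

End LeftQuotient.

HB.instance Definition _ (R : realType) (d : nat) :=
  Topological.copy (SL (adele R) d) (initial_topology (@SL_mx (adele R) d)).
HB.instance Definition _ (R : realType) (d : nat) :=
  isPointed.Build (SL (adele R) d) 1%g.
HB.instance Definition _ (R : realType) (d : nat) :=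
  Topological.copy (ASL (adele R) d) (initial_topology (@ASL_pair (adele R) d)).
HB.instance Definition _ (R : realType) (d : nat) :=
  isPointed.Build (ASL (adele R) d) 1%g.

Section Quotients.
Variables (R : realType) (d : nat).

Definition SL_quot := quotient_topology
  (lquot (@SL_map rat (adele R) (@delta R) d)).
Definition ASL_quot := quotient_topology
  (lquot (@ASL_map rat (adele R) (@delta R) d)).

HB.instance Definition _ := PointedTopological.on SL_quot.
HB.instance Definition _ := PointedTopological.on ASL_quot.

End Quotients.

Notation borel T := (g_sigma_algebraType (@open T)).

Definition boundary (T : topologicalType) (A : set T) : set T :=
  closure A `\` A°.

(* In A_f^d, "bounded" means relatively compact. *)
Definition bounded_in (T : topologicalType) (A : set T) : Prop :=
  exists2 K : set T, compact K & A `<=` K.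

Section Statement.
Variables (R : realType) (d : nat).

Definition SL_invariant (mu : probability (borel (SL_quot R d)) R) : Prop :=
  forall (g : SL (adele R) d) (B : set (borel (SL_quot R d))),
    measurable B -> mu (lquot_mulr g @^-1` B) = mu B.

Definition ASL_invariant (mu : probability (borel (ASL_quot R d)) R) : Prop :=
  forall (g : ASL (adele R) d) (B : set (borel (ASL_quot R d))),
    measurable B -> mu (lquot_mulr g @^-1` B) = mu B.

(* Haar measures on A_f^d; the normalization is left free. *)
Definition haar (m : {measure set (borel 'rV[fadele]_d) -> \bar R}) : Prop :=
  [/\ forall (v : 'rV[fadele]_d) (B : set (borel 'rV[fadele]_d)),
        measurable B -> m ((fun x : 'rV[fadele]_d => x + v) @^-1` B) = m B,
      forall K : set 'rV[fadele]_d, compact K -> (m K < +oo)%E &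
      m setT != 0%E].

Definition adele_inf (x : 'rV[adele R]_d) : 'rV[R]_d :=
  map_mx (fun a : adele R => a.1) x.

Definition adele_fin m (x : 'M[adele R]_(m, d)) : 'M[fadele]_(m, d) :=
  map_mx (fun a : adele R => a.2) x.

Definition deltaQ : set 'rV[adele R]_d := range (map_mx (@delta R)).

(* The index 0 : 'I_d carries the coordinate x_1. *)
Definition cylinder (xi : R) : set 'rV[R]_d :=
  [set x | (forall i : 'I_d, val i = 0%N -> 0 < x 0 i < xi) /\
           \sum_(i < d | val i != 0%N) x 0 i ^+ 2 < 1].

Definition cylinder_window (xi : R) (W : set 'rV[fadele]_d) :
    set 'rV[adele R]_d :=
  [set x | cylinder xi (adele_inf x) /\ W (adele_fin x)].

Definition ASL_void (xi : R) (W : set 'rV[fadele]_d) : set (ASL_quot R d) :=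
  [set g : ASL_quot R d |
    ((fun x => ASL_act x (repr g)) @` deltaQ) `&` cylinder_window xi W = set0].

Definition SL_void (xi : R) (W : set 'rV[fadele]_d) : set (SL_quot R d) :=
  [set M : SL_quot R d |
    ((fun x => x *m repr M) @` deltaQ) `&` cylinder_window xi W = set0].

Definition shift_window (A : SL (adele R) d) (W : set 'rV[fadele]_d)
    (beta : 'rV[adele R]_d) : set 'rV[fadele]_d :=
  [set w - adele_fin beta *m adele_fin A | w in W].

(* The rational vector q with alpha = q, hence beta = delta q, is unique. *)
Definition F_P (muASL : probability (borel (ASL_quot R d)) R)
    (muSL : probability (borel (SL_quot R d)) R)
    (A : SL (adele R) d) (W : set 'rV[fadele]_d) (alpha : 'rV[R]_d)
    (xi : R) : R :=
  match pselect (exists q : 'rV[rat]_d, alpha = map_mx ratr q) with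
  | left alphaQ =>
      let beta := map_mx (@delta R) (projT1 (cid alphaQ)) in
      fine (muSL (SL_void xi (shift_window A W beta)))
  | right _ => fine (muASL (ASL_void xi W))
  end.

End Statement.

(* Main.v *)
(**
  Write [Q^d g] for the orbit of the rational vectors under [g]. It meets every
  bounded subset of [A^d] in a finite set, because a rational vector whose
  denominators and real size are bounded ranges over a finite set. Hence the
  number of points of [Q^d g] in (bounded open) x (bounded Borel) is finite; it
  is lower semicontinuous in [g] when the finite window is open, and Dynkin's
  lemma makes it Borel for all Borel windows, so the void events are measurable.

  The void probability is nonincreasing in [xi] and, as the cylinders are open,
  continuous from the left. If it jumps to the right of [xi], the jump event [J]
  consists of lattices with a point on the wall [x_1 = xi] of the cylinder. Let
  [h_i = diag(s_i, 1/s_i, 1, ...)] at the real place, [s_i = 1 + 1/(i+1)]: the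
  events [J h_i^-1] all have the probability of [J] by invariance, and they
  force points on the distinct walls [x_1 = xi / s_i] inside one bounded set.
  By finiteness each lattice lies in finitely many of them only, so [J] has
  probability 0. No Siegel formula is needed.
*)

Require Import Defs.
From HB Require Import structures.
From mathcomp Require Import all_boot all_order all_algebra.
From mathcomp Require Import all_classical all_reals all_analysis.
From mathcomp Require Import measurable_realfun.
From mathcomp Require Import ring lra zify.

Set Implicit Arguments.
Unset Strict Implicit.
Unset Printing Implicit Defensive.
Import Order.TTheory GRing.Theory Num.Theory.
Import numFieldNormedType.Exports.

Local Open Scope classical_set_scope.
Local Open Scope ring_scope.

(* The ring of p-adic integers, not the group of residues of [zmodp]. *)
Local Notation Zp := Defs.Zp.

(** When finitely many orbit points each persist on a neighbourhood, or each disappear from some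
    index on, one neighbourhood or one index serves them all. *)
Lemma filter_finite_forall (T I : Type) (F : set_system T) {FF : Filter F}
    (A : set I) (P : I -> T -> Prop) : finite_set A ->
  (forall i, A i -> \forall t \near F, P i t) ->
  \forall t \near F, forall i, A i -> P i t.
Proof.
elim/Pchoice: I => I in A P *.
move=> /finite_seqP[s ->]; elim: s => [|a s IH] H; first exact: filterE.
have Hs : \forall t \near F, forall i, i \in s -> P i t.
  by apply: IH => i /= si; apply: H; rewrite /= inE si orbT.
have Ha : \forall t \near F, P a t by apply: H; rewrite /= mem_head.
by apply: filterS2 Ha Hs => t Pa Ps i /=; rewrite inE => /predU1P[->|/Ps].
Qed.

(** * Cardinalities of finite sets as measurable functions *)

Section Counting.
Local Open Scope ereal_scope.
Variable R : realType.

Lemma counting_image (I J : choiceType) (f : I -> J) (A : set I) :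
  injective f -> finite_set A -> @counting J R (f @` A) = counting A.
Proof.
move=> fI fA; rewrite /counting !asboolT//; last exact: finite_image.
by rewrite fset_set_image// finmap.card_imfset.
Qed.

Lemma counting_fin_num (I : choiceType) (A : set I) :
  finite_set A -> @counting I R A \is a fin_num.
Proof. by move=> fA; rewrite /counting asboolT. Qed.

(** Infinite sets are covered too: they count as [+oo], which is nonzero. *)
Lemma counting_eq0 (I : choiceType) (A : set I) :
  (@counting I R A == 0) = (A == set0).
Proof.
rewrite /counting; case: asboolP => [fA|nfA]; last first.
  by apply/esym/negbTE/eqP => A0; apply: nfA; rewrite A0.
rewrite eqe pnatr_eq0 finmap.cardfs_eq0; apply/eqP/eqP => [h|->].
  by rewrite -(fset_setK fA) h set_fset0.
by rewrite fset_set0.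
Qed.

Lemma le_counting (I : choiceType) (A B : set I) :
  A `<=` B -> finite_set B -> @counting I R A <= counting B.
Proof.
move=> AB fB; have fA : finite_set A := sub_finite_set AB fB.
rewrite /counting !asboolT// lee_fin ler_nat finmap.fsubset_leq_card//.
by rewrite -fset_set_sub.
Qed.

(* Counting, unlike the mere event of being nonempty, is additive in [E]. *)
Lemma measurable_counting_dynkin (X Y : ptopologicalType) (I : pointedType)
    (J : X -> set I) (a : X -> I -> Y) :
  (forall x, finite_set (J x)) ->
  (forall U : set Y, open U ->
    @measurable_fun _ _ (borel X) (\bar R) setT
      (fun x => counting (J x `&` a x @^-1` U))) ->
  forall E : set (borel Y), measurable E ->
    @measurable_fun _ _ (borel X) (\bar R) setT
      (fun x => counting (J x `&` a x @^-1` E)).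
Proof.
move=> fJ mU.
(* Every set is measurable in [TI], so the measure identities for [counting] apply to all sets of
   indices. *)
pose TI := g_sigma_algebraType [set: set I].
have mTI (A : set TI) : measurable A by exact: sub_sigma_algebra.
apply: (@dynkin_induction _ (borel Y) open
  (fun E => @measurable_fun _ _ (borel X) (\bar R) setT
      (fun x => counting (J x `&` a x @^-1` E)))) => //.
- exact: openI.
- by apply: mU; exact: openT.
- move=> E mE mcE.
  (* Complement: the total count minus the count in [E]. Both are finite, so the subtraction is
     legitimate. *)
  apply: (eq_measurable_fun (fun x : borel X =>
    @counting I R (J x `&` a x @^-1` setT) -
    @counting I R (J x `&` a x @^-1` E))).
    move=> x _; rewrite preimage_setT setIT.
    have fE : finite_set (J x `&` a x @^-1` E).
      by apply: sub_finite_set (fJ x) => ? [].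
    have sJ : J x `&` a x @^-1` E `<=` J x by move=> ? [].
    have JE : @counting I R (J x) = counting (J x `&` a x @^-1` E) +
        counting (J x `\` (J x `&` a x @^-1` E)).
      rewrite -[in LHS](setDUK sJ).
      apply: (@measureU _ R TI counting) => //.
      by apply/seteqP; split => // y [[? ?] [? ]]; apply.
    rewrite JE [X in X - _]addeC addeK ?counting_fin_num//; congr counting.
    apply/seteqP; split => y /=; first by move=> [Jy nE]; split => // Ey; exact: nE.
    by move=> [Jy nE]; split => // -[].
  apply: emeasurable_funB => //.
  by apply: mU; exact: openT.
- move=> F mF tF mcF.
  apply: (eq_measurable_fun (fun x : borel X =>
    \sum_(0 <= k <oo) @counting I R (J x `&` a x @^-1` F k))).
    move=> x _; apply/esym; rewrite preimage_bigcup setI_bigcupr.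
    apply: (@measure_semi_bigcup _ R TI counting
      (fun k => J x `&` a x @^-1` F k)) => //.
    move=> i j _ _ [y [[_ Fi] [_ Fj]]]; apply: tF => //; by exists (a x y).
  by apply: ge0_emeasurable_sum => // k x _ _; exact: (@measure_ge0 _ TI R counting).
Qed.

(* [S] is defined on lifts [g] only; two lifts of the same point may give
   different sets, provided that these have the same cardinality. *)
Lemma measurable_counting_quotient (X : ptopologicalType) (G : topologicalType)
    (I : choiceType) (pi : G -> X) (N : X -> \bar R) (S : G -> set I) :
  (forall U : set X, open (pi @^-1` U) -> open U) ->
  (forall g, N (pi g) = counting (S g)) ->
  (forall g, finite_set (S g)) ->
  (forall i, open [set g | S g i]) ->
  measurable_fun setT (N : borel X -> \bar R).
Proof.
(* It suffices to treat upper rays, whose preimages are open: the finitely many members of [S g0]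
   persist near [g0], so the cardinality cannot drop. *)
move=> opi NS fS oS; apply: (measurability _ (ErealGenOInfty.measurableE R)).
move=> _ [_ [r ->] <-]; rewrite setTI; apply: sub_sigma_algebra.
apply: opi; rewrite openE => g0 /=; rewrite in_itv/= andbT NS => rg0.
have : \forall g \near g0, forall i, S g0 i -> S g i.
  by apply: filter_finite_forall => // i Si; exact: open_nbhs_nbhs (conj (oS i) Si).
apply: filterS => g Sg; rewrite /= in_itv/= andbT NS.
by apply: lt_le_trans rg0 _; exact: le_counting.
Qed.

End Counting.

(** * Balls of the p-adic numbers and closure properties of [Zp] *)

Section QpBalls.
Variable p : primes_type.
Implicit Types x y : Qp p.

Lemma Qp_abs0 : Qp_abs (0 : Qp p) = 0.
Proof. by rewrite -(rmorph0 (ratQp p)) Qp_abs_rat padic_abs0. Qed.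

Lemma Qp_absD_lt x y e : Qp_abs x < e -> Qp_abs y < e -> Qp_abs (x + y) < e.
Proof. by move=> xe ye; apply: le_lt_trans (Qp_absD _ _) _; rewrite gt_max xe. Qed.

Lemma Qp_ball_open x (e : rat) : open [set y | Qp_abs (y - x) < e].
Proof.
move=> y /= yx; exists e; first exact: le_lt_trans (Qp_abs_ge0 _) yx.
move=> z zy; rewrite /= -(subrK y z) -addrA; exact: Qp_absD_lt.
Qed.

Lemma ZpD x y : Zp x -> Zp y -> Zp (x + y).
Proof.
move=> Zx Zy; apply: le_trans (Qp_absD _ _) _.
by rewrite ge_max; apply/andP.
Qed.

Lemma ZpM x y : Zp x -> Zp y -> Zp (x * y).
Proof. by move=> Zx Zy; rewrite /Zp/= Qp_absM mulr_ile1 ?Qp_abs_ge0. Qed.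

Lemma Zp_one : Zp (1 : Qp p).
Proof. by rewrite /Zp /= -(rmorph1 (ratQp p)) Qp_abs_rat padic_abs1. Qed.

Lemma Zp_zero : Zp (0 : Qp p).
Proof. by rewrite /Zp /= Qp_abs0. Qed.

Lemma Zp_nat n : Zp (n%:R : Qp p).
Proof. elim: n => [|n IH]; [exact: Zp_zero|rewrite -natr1]; exact: ZpD Zp_one. Qed.

End QpBalls.

(** * Continuity of addition and multiplication of finite adeles *)

Lemma fadele_box_open (V : forall p, set (Qp p)) :
  (forall p, open (V p)) -> finite_set [set p | V p != @Zp p] ->
  open [set t : fadele | forall p, V p (fadele_val t p)].
Proof.
move=> oV fV; change (fadele_open [set t | forall p, V p (fadele_val t p)]).
by move=> t Vt; exists V; split.
Qed.

(** Continuity at each prime gives a radius for each prime, but a box of the restricted product must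
    be [Zp] at almost all primes; there the stability of [Zp] under the operation takes over. *)
Lemma fadele_continuous2 (op : fadele -> fadele -> fadele)
    (opp : forall p, Qp p -> Qp p -> Qp p) :
  (forall x y p, fadele_val (op x y) p = opp p (fadele_val x p) (fadele_val y p)) ->
  (forall p x y (e : rat), 0 < e -> exists2 d : rat, 0 < d & forall u w,
    Qp_abs (u - x) < d -> Qp_abs (w - y) < d ->
    Qp_abs (opp p u w - opp p x y) < e) ->
  (forall p u w, Zp u -> Zp w -> Zp (opp p u w)) ->
  continuous (fun z : fadele * fadele => op z.1 z.2).
Proof.
move=> opE cop Zop [x y] U /=; rewrite nbhsE => -[U' [oU' U'xy] U'U].
have [V [oV fV Vxy VU]] := oU' _ U'xy.
have exd : forall p, exists d : rat, 0 < d /\ forall u w,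
    Qp_abs (u - fadele_val x p) < d -> Qp_abs (w - fadele_val y p) < d ->
    V p (opp p u w).
  move=> p; have Vp := Vxy p; rewrite opE in Vp; have [e e0 He] := oV p _ Vp.
  have [d d0 Hd] := cop p (fadele_val x p) (fadele_val y p) e e0.
  by exists d; split => // u w ? ?; apply: He; exact: Hd.
have [d Hd] := choice exd.
(* All but finitely many primes are [good], as [x] and [y] are restricted and [V] is a box. *)
pose good p := [/\ V p = @Zp p, Zp (fadele_val x p) & Zp (fadele_val y p)].
pose B (z : fadele) p : set (Qp p) := if pselect (good p) then @Zp p
  else [set u | Qp_abs (u - fadele_val z p) < d p].
have oB z p : open (B z p).
  by rewrite /B; case: pselect => ?; [exact: Zp_open|exact: Qp_ball_open].
have fB z : finite_set [set p | B z p != @Zp p].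
  apply: sub_finite_set (_ : _ `<=` [set p | V p != @Zp p] `|`
    ([set p | ~ Zp (fadele_val x p)] `|` [set p | ~ Zp (fadele_val y p)])) _.
    move=> p /=; rewrite /B; case: pselect => [?|ng _]; first by rewrite eqxx.
    have [Vp|Vp] := eqVneq (V p) (@Zp p); last by left.
    right; apply: contrapT => /not_orP[/contrapT h1 /contrapT h2].
    by apply: ng; split.
  rewrite !finite_setU; split => //; split; apply: asboolW.
    exact: (fadeleP x).
  exact: (fadeleP y).
have Bx p : B x p (fadele_val x p).
  by rewrite /B; case: pselect => [[]|?] //=; rewrite subrr Qp_abs0; case: (Hd p).
have By p : B y p (fadele_val y p).
  by rewrite /B; case: pselect => [[]|?] //=; rewrite subrr Qp_abs0; case: (Hd p).
have nB z : (forall p, B z p (fadele_val z p)) ->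
    nbhs z [set t : fadele | forall p, B z p (fadele_val t p)].
  by move=> Bz; apply: open_nbhs_nbhs; split => //; exact: fadele_box_open.
exists ([set t : fadele | forall p, B x p (fadele_val t p)],
        [set t : fadele | forall p, B y p (fadele_val t p)]).
  by split; exact: nB.
move=> [u w] [/= Bu Bw]; apply: U'U; apply: VU => p; rewrite opE.
have := Bu p; have := Bw p; rewrite /B; case: pselect => [[Vp ? ?]|?] /=.
  by move=> ? ?; rewrite Vp; exact: Zop.
by move=> ? ?; have [_] := Hd p; exact.
Qed.

Lemma fadele_add_continuous : continuous (fun z : fadele * fadele => z.1 + z.2).
Proof.
apply: (@fadele_continuous2 +%R (fun p => +%R)) => //; last exact: ZpD.
move=> p x y e e0; exists e => // u w ux wy.
have -> : u + w - (x + y) = (u - x) + (w - y) by rewrite opprD addrACA.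
exact: Qp_absD_lt.
Qed.

Lemma fadele_mul_continuous : continuous (fun z : fadele * fadele => z.1 * z.2).
Proof.
apply: (@fadele_continuous2 *%R (fun p => *%R)) => //; last exact: ZpM.
move=> p x y e e0; have xp : 0 < Qp_abs x + Qp_abs y + 1.
  by rewrite ltr_wpDl// addr_ge0 ?Qp_abs_ge0.
(* This radius makes each of the three terms in the expansion of [u * w - x * y] smaller than [e];
   by the ultrametric inequality so is their sum. *)
exists (Num.min 1 (e / (Qp_abs x + Qp_abs y + 1))).
  by rewrite lt_min ltr01 divr_gt0.
move=> u w; rewrite !lt_min !ltr_pdivlMr// => /andP[u1 ux] /andP[w1 wy].
have -> : u * w - x * y = (u - x) * (w - y) + ((u - x) * y + x * (w - y)) by ring.
have x0 := Qp_abs_ge0 x; have y0 := Qp_abs_ge0 y.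
have a0 := Qp_abs_ge0 (u - x); have b0 := Qp_abs_ge0 (w - y).
apply: Qp_absD_lt; last apply: Qp_absD_lt; rewrite Qp_absM; nra.
Qed.

(** * Denominators of finite adeles *)

Definition Zhat (x : fadele) : Prop := forall p, Zp (fadele_val x p).

(** For positive [N] this is the fractional ideal $N^{-1}\hat{\mathbb{Z}}$; for [N = 0] it is the
    whole ring, whence the positivity conditions on [N] below. *)
Definition fint (N : nat) (x : fadele) : Prop := Zhat (N%:R * x).

Lemma fadele_val_nat N p : fadele_val N%:R p = N%:R.
Proof. by elim: N => [//|N IH]; rewrite -[RHS]natr1 -IH -natr1. Qed.

Lemma ZhatD x y : Zhat x -> Zhat y -> Zhat (x + y).
Proof. by move=> Zx Zy p; exact: ZpD. Qed.

Lemma ZhatM x y : Zhat x -> Zhat y -> Zhat (x * y).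
Proof. by move=> Zx Zy p; exact: ZpM. Qed.

Lemma Zhat_nat N : Zhat N%:R.
Proof. by move=> p; rewrite fadele_val_nat; exact: Zp_nat. Qed.

Lemma fintD N x y : fint N x -> fint N y -> fint N (x + y).
Proof. by rewrite /fint mulrDr; exact: ZhatD. Qed.

Lemma fintM N M x y : fint N x -> fint M y -> fint (N * M) (x * y).
Proof. by move=> Nx My; rewrite /fint natrM mulrACA; exact: ZhatM. Qed.

Lemma fint_dvdn N M x : (N %| M)%N -> fint N x -> fint M x.
Proof.
move=> /dvdnP[k ->] Nx; rewrite /fint natrM -mulrA.
by apply: ZhatM => //; exact: Zhat_nat.
Qed.

Lemma fint_sum (I : Type) (r : seq I) (F : I -> fadele) N :
  (forall i, fint N (F i)) -> fint N (\sum_(i <- r) F i).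
Proof.
move=> NF; elim/big_ind : _ => // [|x y]; last exact: fintD.
by rewrite /fint mulr0; exact: (Zhat_nat 0).
Qed.

Lemma Zhat_open : open [set x | Zhat x].
Proof.
apply: fadele_box_open => [p|]; first exact: Zp_open.
by rewrite (_ : [set p | _] = set0) // -subset0 => p /=; rewrite eqxx.
Qed.

Lemma fadele_cvgD (T : Type) (F : set_system T) {FF : Filter F}
    (f g : T -> fadele) (a b : fadele) :
  f @ F --> a -> g @ F --> b -> (fun x => f x + g x) @ F --> a + b.
Proof.
move=> fa gb; apply: (@continuous2_cvg T fadele fadele fadele F FF f g +%R a b _ fa gb).
exact: (@fadele_add_continuous (a, b)).
Qed.

Lemma fadele_cvgM (T : Type) (F : set_system T) {FF : Filter F}
    (f g : T -> fadele) (a b : fadele) :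
  f @ F --> a -> g @ F --> b -> (fun x => f x * g x) @ F --> a * b.
Proof.
move=> fa gb; apply: (@continuous2_cvg T fadele fadele fadele F FF f g *%R a b _ fa gb).
exact: (@fadele_mul_continuous (a, b)).
Qed.

Lemma fint_open N : open [set x | fint N x].
Proof.
change (open ((fun x => N%:R * x) @^-1` [set x | Zhat x])).
apply: open_comp; last exact: Zhat_open.
by move=> x _; apply: (@fadele_cvgM _ (nbhs x) _ (fun=> N%:R) id) => //; exact: cvg_cst.
Qed.

Lemma Qp_abs_prime (p : primes_type) : Qp_abs (p%:R : Qp p) = (p%:R)^-1.
Proof.
have pp : prime p := valP p; have p0 : (p%:R : rat) != 0.
  by rewrite pnatr_eq0 -lt0n prime_gt0.
have -> : (p%:R : Qp p) = ratQp p p%:R by rewrite rmorph_nat.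
rewrite Qp_abs_rat /padic_abs (negPf p0).
have pz : p%:Z != 0 by rewrite eqz_nat -lt0n prime_gt0.
suff -> : padic_val p p%:R = 1 by [].
have -> : (p%:R : rat) = (p%:Z)%:~R / 1%:~R by rewrite divr1.
by rewrite padic_val_frac// logn_prime// eqxx logn1.
Qed.

(** The factor [p ^ k] divides the absolute value by $p^k$, and $p^k > k$, so any [k] above
    [Qp_abs x] will do. *)
Lemma Qp_prime_powM_Zp (p : primes_type) (x : Qp p) :
  exists k, Zp ((p ^ k)%:R * x).
Proof.
have x0 := Qp_abs_ge0 x; exists (Num.bound (Qp_abs x)).
set k := Num.bound _; have p0 : 0 < p%:R :> rat := prime_gt0Q p.
have -> : Zp ((p ^ k)%:R * x) = (Qp_abs ((p%:R : Qp p) ^+ k) * Qp_abs x <= 1) :> Prop.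
  by rewrite natrX /Zp /= Qp_absM.
have -> : Qp_abs ((p%:R : Qp p) ^+ k) = (p%:R ^+ k)^-1.
  elim: k => [|k IH]; last by rewrite !exprS Qp_absM IH Qp_abs_prime invfM.
  by rewrite !expr0 invr1 -(rmorph1 (ratQp p)) Qp_abs_rat padic_abs1.
rewrite mulrC ler_pdivrMr ?exprn_gt0// mul1r.
apply: le_trans (ltW (archi_boundP x0)) _; rewrite -/k -natrX ler_nat.
by rewrite ltnW// ltn_expl// prime_gt1// (valP p).
Qed.

(** Only finitely many primes are bad; a product of powers of them clears the denominators, and an
    integer factor harms no other prime. *)
Lemma fint_ex (x : fadele) : exists2 N, (0 < N)%N & fint N x.
Proof.
suff [N N0 HN] : exists2 N, (0 < N)%N & forall p : primes_type,
    ~ Zp (fadele_val x p) -> Zp (fadele_val (N%:R * x) p).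
  exists N => // p; have [Zx|/HN//] := pselect (Zp (fadele_val x p)).
  by apply: ZpM => //; exact: Zhat_nat.
have /asboolW/finite_seqP[s bad] := fadeleP x.
suff [N N0 HN] : exists2 N, (0 < N)%N & forall p : primes_type,
    p \in s -> Zp (fadele_val (N%:R * x) p).
  by exists N => // p xp; apply: HN; have : [set p | ~ Zp (fadele_val x p)] p by []; rewrite bad.
elim: s {bad} => [|p s [N N0 HN]]; first by exists 1%N.
have [k Hk] := Qp_prime_powM_Zp (fadele_val x p).
exists (prime_of p ^ k * N)%N; first by rewrite muln_gt0 expn_gt0 prime_gt0 ?(valP p).
move=> q; rewrite inE => /predU1P[->|qs].
  rewrite natrM mulrAC [_ * N%:R]mulrC; apply: ZpM; first exact: Zhat_nat.
  change (Zp (fadele_val (prime_of p ^ k)%:R p * fadele_val x p)).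
  by rewrite fadele_val_nat.
rewrite natrM -mulrA; apply: ZpM; [exact: Zhat_nat|exact: HN].
Qed.

Lemma fint_ex_fin (I : finType) (x : I -> fadele) :
  exists2 N, (0 < N)%N & forall i, fint N (x i).
Proof.
have /choice[N HN] : forall i, exists N, (0 < N)%N /\ fint N (x i).
  by move=> i; have [N N0 Nx] := fint_ex (x i); exists N.
exists (\prod_i N i)%N; first by rewrite prodn_gt0// => i; case: (HN i).
move=> i; have [_] := HN i; apply: fint_dvdn.
by rewrite (bigD1 i)//= dvdn_mulr.
Qed.

(** The vectors with entries in [fint N] form open sets that exhaust the space. Factorials arrange
    them in an increasing chain, from which compactness selects one member. *)
Lemma compact_fint d (K : set 'rV[fadele]_d) : compact K ->
  exists2 N, (0 < N)%N & forall w, K w -> forall j, fint N (w 0 j).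
Proof.
move=> /compact_near_coveringP/(_ nat \oo (fun N w => forall j, fint N`! (w 0 j))).
case=> [w Kw|N _ HN].
  have [N0 N00 HN0] := fint_ex_fin (fun j => w 0 j).
  exists ([set w' : 'rV[fadele]_d | forall j, fint N0 (w' 0 j)],
          [set N | (N0 <= N)%N]).
    split; last by exists N0.
    exists (fun _ _ => [set x | fint N0 x]) => [i j|w' h j]; last exact: h.
    by apply: open_nbhs_nbhs; split; [exact: fint_open|rewrite ord1; exact: HN0].
  move=> [w' N] [/= h N0N] j; apply: fint_dvdn (h j).
  by apply: dvdn_fact; rewrite N00.
by exists N`!; [exact: fact_gt0|move=> w Kw; exact: (HN N (leqnn N) w Kw)].
Qed.

(** * Finiteness of the rational vectors of bounded denominator and size *)

Lemma padic_integral_int (q : rat) :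
  (forall p, padic_abs p q <= 1) -> exists z : int, q = z%:~R.
Proof.
move=> Hq; have [->|q0] := eqVneq q 0; first by exists 0.
suff d1 : denq q = 1 by exists (numq q); rewrite -[LHS]divq_num_den d1 divr1.
apply/eqP; have := denq_gt0 q; case E : (denq q) => [m|//] m0.
apply: contraT => m1; have m2 : (1 < m)%N.
  by rewrite ltn_neqAle eq_sym; apply/andP.
(* A prime factor of the denominator does not divide the numerator, so [q] fails to be integral
   there. *)
pose p : primes_type := exist _ (pdiv m) (pdiv_prime m2).
have := Hq p; rewrite padic_abs_le1// /padic_val E /=.
have pm : (0 < logn (pdiv m) m)%N.
  by rewrite logn_gt0 mem_primes pdiv_prime// pdiv_dvd ltnW.
have pn : logn (pdiv m) `|numq q| = 0%N.
  apply/eqP; rewrite -leqn0 leqNgt logn_gt0 mem_primes; apply/negP => /and3P[_ _ pn].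
  have := coprime_num_den q; rewrite E /coprime /= => /eqP g1.
  have : (pdiv m %| gcdn `|numq q| m)%N by rewrite dvdn_gcd pn pdiv_dvd.
  by rewrite g1 dvdn1 => /eqP p1; have := pdiv_prime m2; rewrite p1.
by change (logn p `|numq q|) with (logn (pdiv m) `|numq q|);
  change (logn p m) with (logn (pdiv m) m); rewrite pn; lia.
Qed.

Lemma finite_rat_fint_bounded (R : realType) N (B : R) : (0 < N)%N ->
  finite_set [set q : rat | fint N (ratfadele q) /\ `|ratr q| <= B].
Proof.
move=> N0; pose K := Num.bound (N%:R * `|B|).
(* [N * q] is an integer between [-K] and [K]; adding [K] encodes it as a natural number at most
   [K + K]. *)
apply: (@sub_finite_set _ _
  ((fun n : nat => ((n%:Z - K%:Z)%:~R / N%:R : rat)) @` `I_(K + K).+1)); last first.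
  exact: finite_image.
move=> q [Nq qB].
have [z qz] : exists z : int, N%:R * q = z%:~R.
  apply: padic_integral_int => p; have := Nq p.
  have -> : N%:R * ratfadele q = ratfadele (N%:R * q) by rewrite rmorphM rmorph_nat.
  by rewrite /Zp /= Qp_abs_rat.
have NQ0 : (N%:R : rat) != 0 by rewrite pnatr_eq0 -lt0n.
have zK : `|z| <= K%:Z.
  rewrite -(ler_int R) intr_norm -(ratr_int R z) -qz rmorphM /= ratr_nat normrM.
  apply: le_trans (ltW (archi_boundP _)); last by rewrite mulr_ge0.
  by rewrite normr_nat ler_wpM2l// (le_trans qB)// ler_norm.
exists (absz (z + K%:Z)); first by rewrite /=; lia.
have -> : (absz (z + K%:Z))%:Z - K%:Z = z by lia.
by rewrite -qz mulrC mulKf.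
Qed.

Lemma finite_rV (T : choiceType) d (A : set T) : finite_set A ->
  finite_set [set v : 'rV[T]_d | forall j, A (v 0 j)].
Proof.
move=> /finite_seqP[s ->].
apply: (@sub_finite_set _ _
  ((fun f : {ffun 'I_d -> seq_sub s} => \row_j val (f j)) @` setT)); last first.
  by apply: finite_image; exact: finite_finset.
move=> v sv; exists [ffun j => SeqSub (sv j)] => //.
by apply/rowP => j; rewrite mxE ffunE.
Qed.

(** * Entrywise convergence of matrices, and Borel preimages *)

Lemma cvg_mx (T : Type) (V : topologicalType) m n (F : set_system T)
    {FF : Filter F} (f : T -> 'M[V]_(m, n)) (M : 'M[V]_(m, n)) :
  (forall i j, (fun t => f t i j) @ F --> M i j) -> f @ F --> M.
Proof.
move=> fM A [P MP sPA]; apply: (filterS (fun t => sPA (f t))).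
have : \forall t \near F, forall ij : 'I_m * 'I_n, setT ij -> P ij.1 ij.2 (f t ij.1 ij.2).
  apply: filter_finite_forall; first exact: finite_finset.
  by move=> [i j] _; apply: (fM i j); exact: MP.
by apply: filterS => t Pt i j; exact: (Pt (i, j)).
Qed.

Lemma fst_continuous (U V : topologicalType) : continuous (@fst U V).
Proof. by move=> z; exact: cvg_fst. Qed.

Lemma snd_continuous (U V : topologicalType) : continuous (@snd U V).
Proof. by move=> z; exact: cvg_snd. Qed.

Lemma mx_entry_continuous (V : topologicalType) m n i j :
  continuous (fun M : 'M[V]_(m, n) => M i j).
Proof.
move=> M A MA; exists (fun i' j' => if (i' == i) && (j' == j) then A else setT).
  move=> i' j'; case: ifP => [/andP[/eqP-> /eqP->] //|_]; exact: filterT.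
by move=> N /(_ i j); rewrite !eqxx.
Qed.

Lemma continuous_borel_measurable (X Y : ptopologicalType) (f : X -> Y) :
  continuous f -> forall B : set (borel Y), measurable B ->
  measurable (f @^-1` B : set (borel X)).
Proof.
move=> /continuousP cf B mB; rewrite -[X in measurable X]setTI.
have : @measurable_fun _ _ (borel X) (borel Y) setT f.
  apply: (@measurability _ _ (borel X) (borel Y) setT f (@open Y)) => // _ [U oU <-]; rewrite setTI.
  by apply: sub_sigma_algebra; exact: cf.
by apply.
Qed.

(** * Orbits of the rational vectors *)

Section Orbit.
Variables (R : realType) (d : nat).
Implicit Types (g : ASL (adele R) d) (q : 'rV[rat]_d).

(** Points are labelled by rational vectors, so that one point can be followed while [g] varies. *)
Definition orb g q : 'rV[adele R]_d := ASL_act (map_mx (@delta R) q) g.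

Lemma adele_sum1 (I : Type) (r : seq I) (F : I -> adele R) :
  (\sum_(i <- r) F i).1 = \sum_(i <- r) (F i).1.
Proof. by apply: (big_morph (fun a : adele R => a.1)). Qed.

Lemma adele_sum2 (I : Type) (r : seq I) (F : I -> adele R) :
  (\sum_(i <- r) F i).2 = \sum_(i <- r) (F i).2.
Proof. by apply: (big_morph (fun a : adele R => a.2)). Qed.

Lemma ASL_act_inf (x : 'rV[adele R]_d) g j : adele_inf (ASL_act x g) 0 j =
  \sum_i (x 0 i).1 * (ASL_lin g i j).1 + (ASL_tr g 0 j).1.
Proof. by rewrite !mxE /= adele_sum1. Qed.

Lemma ASL_act_fin (x : 'rV[adele R]_d) g j : adele_fin (ASL_act x g) 0 j =
  \sum_i (x 0 i).2 * (ASL_lin g i j).2 + (ASL_tr g 0 j).2.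
Proof. by rewrite !mxE /= adele_sum2. Qed.

Lemma ASL_actM (K : comPzRingType) (x : 'rV[K]_d) (g h : ASL K d) :
  ASL_act x (g * h)%g = ASL_act (ASL_act x g) h.
Proof. by rewrite /ASL_act /= mulmxDl -mulmxA addrA. Qed.

Lemma ASL_act1 (K : comPzRingType) (x : 'rV[K]_d) : ASL_act x 1%g = x.
Proof. by rewrite /ASL_act /= mulmx1 addr0. Qed.

Lemma ASL_actK (K : comPzRingType) (g : ASL K d) :
  cancel (ASL_act^~ g) (ASL_act^~ g^-1%g).
Proof. by move=> x; rewrite -ASL_actM mulgV ASL_act1. Qed.

(** A change of coset representative only relabels the orbit, by the rational affine map [c]. *)
Lemma orb_mapM (c : ASL rat d) g q :
  orb (ASL_map (@delta R) c * g)%g q = orb g (ASL_act q c).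
Proof.
by rewrite /orb ASL_actM; congr ASL_act; rewrite /ASL_act map_mxD map_mxM.
Qed.

(** The entries of the inverse [h] have common denominators and bounded real parts. Applying [h] to
    the orbit points therefore bounds the denominators and the size of [q] itself. *)
Lemma orbit_finite g N (B : R) : (0 < N)%N ->
  finite_set [set q | (forall j, fint N (adele_fin (orb g q) 0 j)) /\
                      (forall j, `|adele_inf (orb g q) 0 j| <= B)].
Proof.
move=> N0; pose h := (g^-1)%g.
have [M M0 HM] := fint_ex_fin (fun ij : 'I_d * 'I_d => (ASL_lin h ij.1 ij.2).2).
have [P P0 HP] := fint_ex_fin (fun j : 'I_d => (ASL_tr h 0 j).2).
pose B' := \sum_j (\sum_i B * `|(ASL_lin h i j).1| + `|(ASL_tr h 0 j).1|).
have fA := @finite_rat_fint_bounded R (N * M * P) B'.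
apply: sub_finite_set (@finite_rV _ d _ (fA _)); last by rewrite !muln_gt0 N0 M0.
move=> q [Nq Bq] j.
have E : map_mx (@delta R) q = ASL_act (orb g q) h by rewrite ASL_actK.
have B0 : 0 <= B by apply: le_trans (Bq j).
split.
  have -> : ratfadele (q 0 j) = adele_fin (map_mx (@delta R) q) 0 j by rewrite !mxE.
  rewrite E ASL_act_fin; apply: fintD.
    apply: (@fint_dvdn (N * M)); first exact: dvdn_mulr.
    apply: fint_sum => i; apply: fintM; last exact: (HM (i, j)).
    by have := Nq i; rewrite mxE.
  by apply: (@fint_dvdn P); [exact: dvdn_mull|exact: HP].
have -> : ratr (q 0 j) = adele_inf (map_mx (@delta R) q) 0 j by rewrite !mxE.
rewrite E ASL_act_inf /B' [leRHS](bigD1 j)//; apply: le_trans (ler_normD _ _) _.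
apply: ler_wpDr.
  by apply: sumr_ge0 => i _; apply: addr_ge0 => //; apply: sumr_ge0 => k _; rewrite mulr_ge0.
rewrite lerD2r; apply: le_trans (ler_norm_sum _ _ _) _.
apply: ler_sum => i _; rewrite normrM ler_wpM2r//.
by have := Bq i; rewrite mxE.
Qed.

Lemma ASL_lin_entry_continuous i j :
  continuous (fun g : ASL (adele R) d => ASL_lin g i j).
Proof.
move=> g; have c1 : ASL_pair g' @[g' --> g] --> ASL_pair g.
  exact: (@initial_continuous _ _ (@ASL_pair (adele R) d)).
have c2 : ASL_lin g' @[g' --> g] --> ASL_lin g.
  exact: (cvg_comp _ _ c1 (@fst_continuous _ _ _)).
have c3 : SL_mx (ASL_lin g') @[g' --> g] --> SL_mx (ASL_lin g).
  exact: (cvg_comp _ _ c2 (@initial_continuous _ _ (@SL_mx (adele R) d) _)).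
exact: (cvg_comp _ _ c3 (@mx_entry_continuous _ _ _ i j _)).
Qed.

Lemma ASL_tr_entry_continuous j :
  continuous (fun g : ASL (adele R) d => ASL_tr g 0 j).
Proof.
move=> g; have c1 : ASL_pair g' @[g' --> g] --> ASL_pair g.
  exact: (@initial_continuous _ _ (@ASL_pair (adele R) d)).
have c2 : ASL_tr g' @[g' --> g] --> ASL_tr g.
  exact: (cvg_comp _ _ c1 (@snd_continuous _ _ _)).
exact: (cvg_comp _ _ c2 (@mx_entry_continuous _ _ _ 0 j _)).
Qed.

Lemma orb_inf_continuous q :
  continuous (fun g : ASL (adele R) d => adele_inf (orb g q)).
Proof.
move=> g; apply: (@cvg_mx _ _ _ _ (nbhs g) (nbhs_filter g)) => i j; rewrite !ord1 ASL_act_inf.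
under eq_fun do rewrite ASL_act_inf.
apply: cvgD; last first.
  exact: (cvg_comp _ _ (@ASL_tr_entry_continuous j g) (@fst_continuous _ _ _)).
apply: (@cvg_big R 'I_d +%R 0 xpredT _ _ (nbhs g)) => [|k _].
  exact: add_continuous.
apply: (@cvgM R _ (nbhs g)); first exact: cvg_cst.
exact: (cvg_comp _ _ (@ASL_lin_entry_continuous k j g) (@fst_continuous _ _ _)).
Qed.

Lemma orb_fin_continuous q :
  continuous (fun g : ASL (adele R) d => adele_fin (orb g q)).
Proof.
move=> g; apply: (@cvg_mx _ _ _ _ (nbhs g) (nbhs_filter g)) => i j; rewrite !ord1 ASL_act_fin.
under eq_fun do rewrite ASL_act_fin.
apply: fadele_cvgD; last first.
  exact: (cvg_comp _ _ (@ASL_tr_entry_continuous j g) (@snd_continuous _ _ _)).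
apply: (cvg_big fadele_add_continuous) => k _.
apply: fadele_cvgM; first exact: cvg_cst.
exact: (cvg_comp _ _ (@ASL_lin_entry_continuous k j g) (@snd_continuous _ _ _)).
Qed.

End Orbit.

(** * Monotonicity, boundedness and openness of the cylinders *)

Definition box_bounded (R : realType) d (C : set 'rV[R]_d) : Prop :=
  exists B : R, forall x, C x -> forall j, `|x 0 j| <= B.

Section Cylinder.
Variables (R : realType) (d : nat).

Lemma cylinder_mono (xi xi' : R) : xi <= xi' -> cylinder (d := d) xi `<=` cylinder xi'.
Proof.
move=> le x [h1 h2]; split => // i /h1/andP[-> h] /=; exact: lt_le_trans h le.
Qed.

Lemma cylinder_bounded (xi : R) : box_bounded (cylinder (d := d) xi).
Proof.
exists (Num.max xi 1) => x [h1 h2] j; rewrite le_max.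
have [/eqP j0|j0] := boolP (val j == 0%N).
  by have /andP[x0 xxi] := h1 j j0; rewrite gtr0_norm// (ltW xxi).
apply/orP; right; rewrite -(@expr_le1 _ 2)// real_normK ?num_real//.
apply: le_trans (ltW h2); rewrite (bigD1 j)//= lerDl.
by apply: sumr_ge0 => i _; exact: sqr_ge0.
Qed.

Lemma cylinder_open (xi : R) : open (cylinder (d := d) xi).
Proof.
have ec (j : 'I_d) (x : 'rV[R]_d) : (y 0 j : R) @[y --> x] --> x 0 j.
  exact: mx_entry_continuous.
rewrite openE => x [h1 h2]; apply: filterI.
  have : \forall y \near x, forall i : 'I_d, val i = 0%N -> 0 < (y : 'rV[R]_d) 0 i < xi.
    apply: (@filter_finite_forall _ _ (nbhs x) _ [set i : 'I_d | val i = 0%N]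
      (fun i y => 0 < y 0 i < xi)); first exact: finite_finset.
    move=> i /h1/andP[x0 xxi]; near=> y; apply/andP; split; near: y.
      exact: (cvgr_gt _ (ec i x)).
    exact: (cvgr_lt _ (ec i x)).
  by [].
have cs : (\sum_(i < d | val i != 0%N) (y : 'rV[R]_d) 0 i ^+ 2) @[y --> x] -->
    \sum_(i < d | val i != 0%N) x 0 i ^+ 2.
  apply: (@cvg_big R 'I_d +%R 0 (fun i => val i != 0%N) _ _ (nbhs x)) => [|k _].
    exact: add_continuous.
  rewrite expr2; under eq_fun do rewrite expr2.
  by apply: (@cvgM R _ (nbhs x)); exact: ec.
exact: (cvgr_lt _ cs).
Unshelve. all: by end_near. Qed.

End Cylinder.

(** * Void events and their measurability *)

(* [G] is [ASL_d(A)] with [emb = id], or [SL_d(A)] embedded with translation 0. *)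
Section Void.
Variables (R : realType) (d : nat) (G : topologicalType) (X : ptopologicalType).
Variables (pi : G -> X) (rep : X -> G) (emb : G -> ASL (adele R) d).
Hypothesis repK : cancel rep pi.
Hypothesis open_pi : forall U : set X, open (pi @^-1` U) -> open U.
Hypothesis emb_continuous : continuous emb.
Hypothesis emb_eq : forall g h, pi g = pi h ->
  exists c : ASL rat d, emb h = (ASL_map (@delta R) c * emb g)%g.

Definition hits (C : set 'rV[R]_d) (W : set 'rV[fadele]_d)
    (g : ASL (adele R) d) : set 'rV[rat]_d :=
  [set q | C (adele_inf (orb g q)) /\ W (adele_fin (orb g q))].

Definition void C W : set X := [set x | hits C W (emb (rep x)) = set0].

(** By this relabelling, the emptiness and the number of hits depend only on the coset. *)
Lemma hits_mapM C W (c : ASL rat d) g :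
  hits C W g = (ASL_act^~ c) @` hits C W (ASL_map (@delta R) c * g)%g.
Proof.
have cK (q : 'rV[rat]_d) : ASL_act (ASL_act q c^-1%g) c = q.
  by rewrite -ASL_actM mulVg ASL_act1.
apply/seteqP; split => [q [Cq Wq]|_ [q [Cq Wq] <-]].
  by exists (ASL_act q c^-1%g) => //; rewrite /hits /= orb_mapM cK.
by move: Cq Wq; rewrite orb_mapM.
Qed.

Definition fint_rV (N : nat) : set 'rV[fadele]_d :=
  [set w | forall j, fint N (w 0 j)].

Lemma fint_rV_open N : open (fint_rV N).
Proof.
rewrite openE => w Nw; exists (fun _ _ => [set x | fint N x]).
  by move=> i j; rewrite ord1; apply: open_nbhs_nbhs; split; [exact: fint_open|exact: Nw].
by move=> w' h j; exact: h.
Qed.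

Lemma hits_finite C N g : (0 < N)%N -> box_bounded C ->
  finite_set (hits C (fint_rV N) g).
Proof.
move=> N0 [B CB]; apply: sub_finite_set (orbit_finite g B N0).
by move=> q [Cq Nq]; split => // j; exact: CB.
Qed.

Lemma hits_open C U q : open C -> open U -> open [set g | hits C U (emb g) q].
Proof.
move=> oC oU.
apply: (@openI _ (emb @^-1` [set g | C (adele_inf (orb g q))])
                 (emb @^-1` [set g | U (adele_fin (orb g q))])).
  apply: open_comp; first by move=> g _; exact: emb_continuous.
  apply: open_comp oC => g _; exact: orb_inf_continuous.
apply: open_comp; first by move=> g _; exact: emb_continuous.
apply: open_comp oU => g _; exact: orb_fin_continuous.
Qed.

Lemma void_measurable C W : open C -> box_bounded C -> bounded_in W ->
  measurable (W : set (borel 'rV[fadele]_d)) ->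
  measurable (void C W : set (borel X)).
Proof.
move=> oC bC [K /compact_fint[N N0 KN] WK] mW.
(* [fint_rV N] is open and contains [W]. Cutting with it keeps the counts finite for the possibly
   unbounded open windows of the Dynkin induction, and leaves these windows open. *)
pose J x := hits C (fint_rV N) (emb (rep x)).
pose a x q := adele_fin (orb (emb (rep x)) q).
have JW (x : X) V : J x `&` a x @^-1` V = hits C (fint_rV N `&` V) (emb (rep x)).
  by apply/seteqP; split => [q [[? ?] ?]|q [? [? ?]]].
have mc : @measurable_fun _ _ (borel X) (\bar R) setT
    (fun x => counting (J x `&` a x @^-1` W)).
  apply: measurable_counting_dynkin mW => [x|U oU]; first exact: hits_finite.
  have oNU : open (fint_rV N `&` U) by apply: openI => //; exact: fint_rV_open.
  have fin g : finite_set (hits C (fint_rV N `&` U) g).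
    by apply: sub_finite_set (hits_finite g N0 bC) => q [? []].
  apply: (@measurable_counting_quotient R X G _ pi _
    (fun g => hits C (fint_rV N `&` U) (emb g))) => //.
    move=> g; rewrite JW.
    (* [g] and the chosen representative of its class differ by a rational factor on the left, hence
       have equally many hits. *)
    have [c ->] := emb_eq (repK (pi g)).
    rewrite (hits_mapM _ _ c (emb (rep (pi g)))) counting_image//.
    exact: can_inj (ASL_actK c).
  by move=> q; exact: hits_open.
have -> : void C W = (fun x : X => @counting _ R (J x `&` a x @^-1` W)) @^-1` [set 0%E].
  apply/seteqP; split => x /=; rewrite /void /= JW => h.
    apply/eqP; rewrite counting_eq0; apply/eqP; rewrite -subset0 -h.
    by move=> q [? []].
  apply/seteqP; split => // q [Cq Wq].
  move/eqP: h; rewrite counting_eq0 => /eqP h.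
  suff : hits C (fint_rV N `&` W) (emb (rep x)) q by rewrite h.
  by split => //; split => // j; apply: KN; exact: WK.
rewrite -[X in measurable X]setTI; exact: mc.
Qed.

End Void.

(** * A criterion for null events and one for continuity of monotone functions *)

Lemma eq_measure_finite_incidence_null (dd : measure_display)
    (T : measurableType dd) (R : realType) (mu : probability T R)
    (F : (set T)^nat) (c : \bar R) :
  (forall i, measurable (F i)) -> (forall x, finite_set [set i | F i x]) ->
  (forall i, mu (F i) = c) -> c = 0%E.
Proof.
(* The tails [G n] decrease to the empty set, as no point lies in infinitely many [F i]; yet each
   tail has measure at least [c]. *)
move=> mF fF Fc; pose G n := \bigcup_(i in [set i | (n <= i)%N]) F i.
have mG n : measurable (G n) by apply: bigcup_measurable => i _; exact: mF.
have G0 : \bigcap_n G n = set0.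
  rewrite -subset0 => x Gx.
  have near_lt : \forall n \near \oo, forall i, F i x -> (i < n)%N.
    apply: (@filter_finite_forall _ _ \oo _ [set i | F i x] (fun i n => (i < n)%N)).
      exact: fF.
    by move=> i _; exact: nbhs_infty_gt.
  have [n Hn] := filter_ex near_lt; have [i /= ni Fi] := Gx n I.
  by have := Hn i Fi; rewrite ltnNge ni.
have cG : mu \o G @ \oo --> (0 : \bar R)%E.
  rewrite -(measure0 mu) -G0; apply: nonincreasing_cvg_mu => //.
  - by apply: le_lt_trans (probability_le1 mu (mG 0%N)) _; exact: ltry.
  - by rewrite G0.
  - move=> m n mn; apply/subsetPset => x [i ni Fi]; exists i => //=.
    exact: leq_trans mn ni.
apply/eqP; rewrite eq_le -{2}(Fc 0%N) measure_ge0 andbT.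
rewrite -(cvg_lim (@ereal_hausdorff R) cG); apply: lime_ge.
  by apply/cvg_ex; exists 0%E.
apply: nearW => n /=; rewrite -(Fc n) le_measure ?inE//.
by move=> x Fx; exists n => /=.
Qed.

(** By monotonicity, the values near [x] are trapped between one value on its left and one on its
    right, so the two sequences suffice. *)
Lemma nonincreasing_continuous_at (R : realType) (f : R -> R) (x : R) :
  {homo f : a b / a <= b >-> b <= a} ->
  f (x - n.+1%:R^-1) @[n --> \oo] --> f x ->
  f (x + n.+1%:R^-1) @[n --> \oo] --> f x ->
  {for x, continuous f}.
Proof.
move=> fm fl fr; apply/cvgrPdist_lt => e e0.
have near_m : \forall n \near \oo, `|f x - f (x - n.+1%:R^-1)| < e.
  by move/cvgrPdist_lt : fl; exact.
have near_n : \forall n \near \oo, `|f x - f (x + n.+1%:R^-1)| < e.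
  by move/cvgrPdist_lt : fr; exact.
have [m Hm] := filter_ex near_m; have [n Hn] := filter_ex near_n.
near=> y.
have y1 : x - m.+1%:R^-1 <= y.
  by apply: ltW; near: y; apply: lt_nbhsr; rewrite ltrBlDr ltrDl invr_gt0.
have y2 : y <= x + n.+1%:R^-1.
  by apply: ltW; near: y; apply: lt_nbhsl; rewrite ltrDl invr_gt0.
have := fm _ _ y1; have := fm _ _ y2; move: Hm Hn; rewrite !ltr_norml.
by move=> /andP[? ?] /andP[? ?] ? ?; apply/andP; split; lra.
Unshelve. all: by end_near. Qed.

(** * Diagonal scalings at the real place *)

Section Scaling.
Variables (R : realType) (d : nat).

(** The factor at index 1 restores determinant 1, which is where [2 <= d] enters. *)
Definition scal_entry (s : R) (i : 'I_d) : R :=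
  if val i == 0%N then s else if val i == 1%N then s^-1 else 1.

Definition scal_mx (s : R) : 'M[adele R]_d :=
  diag_mx (\row_i ((scal_entry s i, 1) : adele R)).

Lemma scal_det (s : R) : (2 <= d)%N -> s != 0 -> \det (scal_mx s) == 1.
Proof.
rewrite /scal_mx /scal_entry; case: d => [|[|n]]// _ s0.
rewrite det_diag !big_ord_recl !mxE /= big1 ?mulr1; last by move=> i _; rewrite mxE.
by apply/eqP; congr pair; rewrite /= ?divff ?mulr1.
Qed.

Definition scal (hd : (2 <= d)%N) (s : R) (s0 : s != 0) : ASL (adele R) d :=
  MkASL (MkSL (scal_det hd s0)) 0.

Lemma orbM_scal_inf hd s s0 g q j : adele_inf (orb (g * @scal hd s s0)%g q) 0 j =
  adele_inf (orb g q) 0 j * scal_entry s j.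
Proof.
by rewrite /orb ASL_actM {1}/ASL_act /= addr0 /scal_mx mul_mx_diag !mxE.
Qed.

Lemma orbM_scal_fin hd s s0 g q :
  adele_fin (orb (g * @scal hd s s0)%g q) = adele_fin (orb g q).
Proof.
apply/rowP => j; rewrite /orb ASL_actM {1}/ASL_act /= addr0 /scal_mx mul_mx_diag.
by rewrite !mxE /= mulr1.
Qed.

Lemma scal_entry_bound s j (x B : R) : s != 0 -> `|x * scal_entry s j| <= B ->
  `|x| <= B * (`|s| + `|s^-1| + 1).
Proof.
move=> s0 xB; have B0 : 0 <= B := le_trans (normr_ge0 _) xB.
have e0 : scal_entry s j != 0.
  by rewrite /scal_entry; case: ifP => // _; case: ifP => _; rewrite ?invr_eq0 ?oner_eq0.
rewrite -[x](mulfK e0) normrM ler_pM// /scal_entry.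
have := normr_ge0 s; have := normr_ge0 s^-1.
by case: ifP => _; [|case: ifP => _]; rewrite ?invrK ?invr1 ?normr1; lra.
Qed.

Definition scal_preim (s : R) (C : set 'rV[R]_d) : set 'rV[R]_d :=
  [set x | C (\row_j (x 0 j * scal_entry s j))].

Lemma scal_preim_open s C : open C -> open (scal_preim s C).
Proof.
apply: open_comp => x _.
apply: (@cvg_mx _ _ _ _ (nbhs x) (nbhs_filter x)) => i j; rewrite ord1 mxE.
under eq_fun do rewrite mxE.
apply: (@cvgM R _ (nbhs x)); last exact: cvg_cst.
exact: mx_entry_continuous.
Qed.

Lemma scal_preim_bounded s C : s != 0 -> box_bounded C ->
  box_bounded (scal_preim s C).
Proof.
move=> s0 [B CB]; exists (B * (`|s| + `|s^-1| + 1)) => x Cx j.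
by apply: (@scal_entry_bound s j) => //; have := CB _ Cx j; rewrite mxE.
Qed.

(** Trades the translation of the lattice for a change of the real region, so that translated void
    events are again void events. *)
Lemma hitsM_scal hd s s0 g C W :
  hits C W (g * @scal hd s s0)%g = hits (scal_preim s C) W g.
Proof.
apply/seteqP; split => q [Cq Wq]; split; rewrite ?orbM_scal_fin in Wq * => //.
  rewrite /scal_preim /=; move: Cq; congr C.
  by apply/rowP => j; rewrite [RHS]mxE orbM_scal_inf.
move: Cq; rewrite /scal_preim /=; congr C.
by apply/rowP => j; rewrite [LHS]mxE orbM_scal_inf.
Qed.

End Scaling.

(** * Continuity of the void probability *)

Section VoidProbability.
Variables (R : realType) (d : nat) (G : topologicalType) (X : ptopologicalType).
Variables (pi : G -> X) (rep : X -> G) (emb : G -> ASL (adele R) d).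
Hypothesis repK : cancel rep pi.
Hypothesis open_pi : forall U : set X, open (pi @^-1` U) -> open U.
Hypothesis emb_continuous : continuous emb.
Hypothesis emb_eq : forall g h, pi g = pi h ->
  exists c : ASL rat d, emb h = (ASL_map (@delta R) c * emb g)%g.
Variable mu : probability (borel X) R.
Hypothesis hd : (2 <= d)%N.
(** [T] will be right translation on the quotient. The representative of [T x] is the translated
    representative of [x] only up to a rational factor [c]. *)
Hypothesis mu_scal : forall s (s0 : s != 0), exists T : X -> X,
  (forall B : set (borel X), measurable B -> mu (T @^-1` B) = mu B) /\
  (forall x, exists c : ASL rat d,
    emb (rep (T x)) = (ASL_map (@delta R) c * (emb (rep x) * scal hd s0))%g).
Variable W : set 'rV[fadele]_d.
Hypothesis W_bounded : bounded_in W.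
Hypothesis W_borel : measurable (W : set (borel 'rV[fadele]_d)).

Let V (xi : R) : set X := void rep emb (cylinder xi) W.
Let i0 : 'I_d := Ordinal (leq_trans (isT : (0 < 2)%N) hd).

Let mvoid C : open C -> box_bounded C ->
  measurable (void rep emb C W : set (borel X)).
Proof. by move=> oC bC; exact: (void_measurable repK). Qed.

Let mV xi : measurable (V xi : set (borel X)).
Proof. by apply: mvoid; [exact: cylinder_open|exact: cylinder_bounded]. Qed.

Let V_mono xi xi' : xi <= xi' -> V xi' `<=` V xi.
Proof.
move=> le x Vx; rewrite /V /void /= -subset0 -Vx => q [Cq Wq].
by split => //; exact: cylinder_mono le _ Cq.
Qed.

(** The measure of this event is the drop of the void probability immediately to the right of
    [xi]. *)
Let jump xi : set X := V xi `\` \bigcup_n V (xi + n.+1%:R^-1).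

(** The hits of the longer cylinders lie in one finite set, so some point hits them all. Its first
    coordinate is at most [xi], and not smaller since the cylinder for [xi] has no hit. *)
Let jump_hit xi x : jump xi x -> exists2 q,
  hits (cylinder (xi + 1)) W (emb (rep x)) q &
  0 < xi /\ adele_inf (orb (emb (rep x)) q) 0 i0 = xi.
Proof.
move=> [Vx nVx]; set g := emb (rep x).
have [K cK WK] := W_bounded; have [N N0 KN] := compact_fint cK.
have finS : finite_set (hits (cylinder (xi + 1)) W g).
  apply: sub_finite_set (hits_finite g N0 (@cylinder_bounded R d (xi + 1))).
  by move=> q [Cq Wq]; split => // j; apply: KN; exact: WK.
have le1 n : xi + n.+1%:R^-1 <= xi + 1 :> R by rewrite lerD2l invf_le1 ?ler1n.
(* Otherwise each of the finitely many candidates is lost from some index on, and some longer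
   cylinder is void, against [nVx]. *)
have [q Hq] : exists q, forall n, hits (cylinder (xi + n.+1%:R^-1)) W g q.
  apply: contrapT => /forallNP noq.
  have near_no : \forall n \near \oo, forall q, hits (cylinder (xi + 1)) W g q ->
      ~ hits (cylinder (xi + n.+1%:R^-1)) W g q.
    apply: (@filter_finite_forall _ _ \oo _ _
      (fun q n => ~ hits (cylinder (xi + n.+1%:R^-1)) W g q) finS) => q _.
    have /existsNP[m Hm] := noq q; exists m => // n /= mn [Cq Wq]; apply: Hm.
    split => //; apply: cylinder_mono Cq.
    by rewrite lerD2l lef_pV2 ?posrE// ler_nat.
  have [n Hn] := filter_ex near_no; apply: nVx; exists n => //.
  rewrite /V /void /= -subset0 => q [Cq Wq].
  by apply: (Hn q) => //; split => //; exact: cylinder_mono (le1 n) _ Cq.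
exists q.
  by have [Cq Wq] := Hq 0%N; split => //; exact: cylinder_mono (le1 0%N) _ Cq.
set v := adele_inf (orb g q) 0 i0.
have v0 : 0 < v by have [[/(_ i0 erefl)/andP[]]] := Hq 0%N.
have vxi : v <= xi.
  rewrite leNgt; apply/negP => xiv.
  have xv : 0 < v - xi by rewrite subr_gt0.
  (* At this index $1/(n+1) \le v - \xi$, so the cylinder ends before it contains [v]. *)
  have [[/(_ i0 erefl)/andP[_ + _] _]] := Hq (Num.bound (v - xi)^-1).
  apply/negP; rewrite -leNgt -/v -lerBrDl invf_ple ?posrE//.
  apply: le_trans (ltW (archi_boundP _)) _; first by rewrite invr_ge0 ltW.
  by rewrite ler_nat.
have vE : v = xi.
  apply: le_anti; rewrite vxi /= leNgt; apply/negP => ltv.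
  have : hits (cylinder xi) W g q.
    have [[h1 h2] Wq] := Hq 0%N; split => //; split => // i iE.
    have -> : i = i0 by apply: val_inj.
    by rewrite -/v v0 ltv.
  by rewrite Vx.
by split; rewrite -vE.
Qed.

Let jump_null xi : mu (jump xi : set (borel X)) = 0%E.
Proof.
have [xi0|xi0] := pselect (0 < xi); last first.
  suff -> : jump xi = set0 by rewrite measure0.
  by rewrite -subset0 => x /jump_hit[q _ []].
(* The factors are distinct, so the walls [xi / s i] are distinct; they lie between 1 and 2, so one
   box contains all the rescaled cylinders. *)
pose s (i : nat) : R := 1 + i.+1%:R^-1.
have s1 i : 1 < s i by rewrite ltrDl invr_gt0.
have s0 i : s i != 0 by rewrite gt_eqF// (lt_trans ltr01).
have s2 i : s i <= 2.
  by rewrite /s (_ : 2 = 1 + 1 :> R)// lerD2l invf_le1 ?ler1n.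
have [T HT] := choice (fun i => mu_scal (s0 i)).
(* Measurability of the preimages under [T i] rests on this: the rescaled regions are again open and
   bounded. *)
have Tvoid i C : T i @^-1` void rep emb C W = void rep emb (scal_preim (s i) C) W.
  apply/seteqP; split => x; rewrite /void /=; have [_ /(_ x)[c ->]] := HT i.
    by move=> h; rewrite -(hitsM_scal hd (s0 i)) (hits_mapM _ _ c) h image_set0.
  move=> h; have : hits C W (emb (rep x) * scal hd (s0 i))%g = set0.
    by rewrite hitsM_scal.
  by rewrite (hits_mapM _ _ c) => /image_set0_set0.
have mTV i z : measurable (T i @^-1` V z : set (borel X)).
  rewrite /V Tvoid; apply: mvoid; first exact/scal_preim_open/cylinder_open.
  by apply: scal_preim_bounded => //; exact: cylinder_bounded.
have mjump : measurable (jump xi : set (borel X)).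
  by apply: measurableD => //; exact: bigcup_measurable.
apply: (@eq_measure_finite_incidence_null _ (borel X) R mu
  (fun i => T i @^-1` jump xi)) => [i|x|i].
- have -> : T i @^-1` jump xi =
      T i @^-1` V xi `\` \bigcup_n (T i @^-1` V (xi + n.+1%:R^-1)).
    by rewrite -preimage_bigcup.
  by apply: measurableD => //; exact: bigcup_measurable.
- set g := emb (rep x).
  have [K cK WK] := W_bounded; have [N N0 KN] := compact_fint cK.
  have [B CB] := @cylinder_bounded R d (xi + 1).
  (* The factor 4 bounds [s i] plus its inverse plus 1, as in [scal_entry_bound]. *)
  pose box := [set y : 'rV[R]_d | forall j, `|y 0 j| <= B * 4].
  have fQ : finite_set (hits box (fint_rV N) g).
    by apply: hits_finite => //; exists (B * 4).
  (* Membership of [x] in the event of index [i] forces a point of [box] with first coordinate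
     [xi / s i]. These values are distinct, so finitely many points allow finitely many [i]. *)
  apply: sub_finite_set (_ : _ `<=` (fun i => xi / s i) @^-1`
    ((fun q => adele_inf (orb g q) 0 i0) @` hits box (fint_rV N) g)) _; last first.
    apply: finite_preimage; last exact: finite_image.
    move=> i j _ _ /(mulfI (lt0r_neq0 xi0))/invr_inj/addrI/invr_inj/eqP.
    by rewrite eqr_nat eqSS => /eqP.
  move=> i /jump_hit[q hq [_ qxi]].
  have [_ /(_ x)[c Ec]] := HT i; rewrite Ec -/g in hq qxi.
  rewrite orb_mapM in qxi; set q' := ASL_act q c in qxi.
  have : hits (cylinder (xi + 1)) W (g * scal hd (s0 i))%g q'.
    by rewrite (hits_mapM _ _ c); exists q.
  rewrite orbM_scal_inf /scal_entry /= in qxi.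
  move=> [Cq Wq]; rewrite orbM_scal_fin in Wq.
  exists q'; last by rewrite -qxi mulfK.
  split; last by move=> j; apply: KN; exact: WK.
  move=> j; have := CB _ Cq j; rewrite orbM_scal_inf => hB.
  apply: le_trans (scal_entry_bound (s0 i) hB) _.
  have B0 : 0 <= B := le_trans (normr_ge0 _) hB.
  rewrite ler_wpM2l// normfV gtr0_norm ?(lt_trans ltr01)//.
  have : (s i)^-1 <= 1 by rewrite invf_le1 ?ltW// (lt_trans ltr01).
  by have := s2 i; lra.
- by have [-> //] := HT i.
Qed.

Lemma void_probability_continuous :
  continuous (fun xi : R => fine (mu (void rep emb (cylinder xi) W))).
Proof.
move=> xi; have muE z : mu (V z) = (fine (mu (V z)))%:E.
  by rewrite fineK// fin_num_measure.
have bV (U : set (borel X)) : measurable U -> (mu U < +oo)%E.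
  by move=> mU; apply: le_lt_trans (probability_le1 mu mU) (ltry _).
apply: nonincreasing_continuous_at.
- move=> a b ab; apply: fine_le; rewrite ?fin_num_measure//; try exact: mV.
  by apply: le_measure; rewrite ?inE; [exact: mV|exact: mV|exact: V_mono].
- apply: fine_cvg; rewrite -/(V xi) -muE.
  (* Left continuity: a hit of the cylinder for [xi] has first coordinate strictly below [xi], so it
     already hits a slightly shorter cylinder. *)
  have VE : V xi = \bigcap_n V (xi - n.+1%:R^-1).
    apply/seteqP; split => x; first by move=> Vx n _; apply: V_mono Vx; rewrite gerBl.
    move=> Vx; rewrite /V /void /= -subset0 => q [[h1 h2] Wq].
    have /andP[v0 vxi] := h1 i0 erefl; set v := adele_inf _ 0 i0 in v0 vxi.
    have xv : 0 < xi - v by rewrite subr_gt0.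
    pose n := Num.bound (xi - v)^-1.
    have <- : hits (cylinder (xi - n.+1%:R^-1)) W (emb (rep x)) = set0 by exact: Vx.
    split => //; split => // i iE; have -> : i = i0 by apply: val_inj.
    rewrite -/v v0 /= ltrBrDl -ltrBrDr invf_plt ?posrE//.
    apply: lt_le_trans (archi_boundP _) _; first by rewrite invr_ge0 ltW.
    by rewrite ler_nat.
  rewrite VE; apply: (@nonincreasing_cvg_mu _ (borel X) R mu
    (fun n => V (xi - n.+1%:R^-1))) => //; first exact: bV.
    by rewrite -VE.
  move=> m n mn; apply/subsetPset; apply: V_mono.
  by rewrite lerD2l lerN2 lef_pV2 ?posrE// ler_nat.
- apply: fine_cvg; rewrite -/(V xi) -muE.
  set U := \bigcup_n V (xi + n.+1%:R^-1).
  have mU : measurable (U : set (borel X)) by exact: bigcup_measurable.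
  have UV : U `<=` V xi.
    by move=> x [n _]; apply: V_mono; rewrite lerDl.
  (* Right continuity: [V xi] exceeds the increasing union [U] only by the null event [jump xi]. *)
  have -> : mu (V xi) = mu U.
    rewrite -[in LHS](setDUK UV) measureU//; last 2 first.
    - by apply: measurableD.
    - by apply/seteqP; split => // x [? []].
    by rewrite [X in (_ + X)%E](_ : _ = 0%E) ?adde0//; exact: jump_null.
  apply: (@nondecreasing_cvg_mu _ (borel X) R mu
    (fun n => V (xi + n.+1%:R^-1))) => //.
  move=> m n mn; apply/subsetPset; apply: V_mono.
  by rewrite lerD2l lef_pV2 ?posrE// ler_nat.
Qed.

End VoidProbability.

(** * Application to the affine and the linear quotient *)

Section Quotients.
Variables (R : realType) (d : nat).

Let lquot_repr (H G : groupType) (f : UMagmaMorphism.type H G) (g h : G) :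
  \pi_(lquot f)%qT g = \pi_(lquot f)%qT h -> exists c, h = (f c * g)%g.
Proof. by move=> /eqmodP/asboolP. Qed.

Lemma ASL_voidE (xi : R) (W : set 'rV[fadele]_d) : ASL_void xi W =
  void (fun x : ASL_quot R d => repr x) id (cylinder xi) W.
Proof.
apply/seteqP; split => g; rewrite /ASL_void /void /= => h.
  rewrite -subset0 => q Hq.
  suff : ((fun x => ASL_act x (repr g)) @` @deltaQ R d `&` cylinder_window xi W)
      (orb (repr g) q) by rewrite h.
  by split => //; exists (map_mx (@delta R) q) => //; exists q.
rewrite -subset0 => _ [[_ [q _ <-] <-] Hq].
by suff : hits (cylinder xi) W (repr g) q by rewrite h.
Qed.

Definition SL_emb (M : SL (adele R) d) : ASL (adele R) d := MkASL M 0.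

Lemma SL_voidE (xi : R) (W : set 'rV[fadele]_d) : SL_void xi W =
  void (fun x : SL_quot R d => repr x) SL_emb (cylinder xi) W.
Proof.
have E (M : SL (adele R) d) q : orb (SL_emb M) q = map_mx (@delta R) q *m M.
  by rewrite /orb /ASL_act /= addr0.
apply/seteqP; split => g; rewrite /SL_void /void /= => h.
  rewrite -subset0 => q; rewrite /hits /= E => Hq.
  suff : ((fun x => x *m repr g) @` @deltaQ R d `&` cylinder_window xi W)
      (map_mx (@delta R) q *m repr g) by rewrite h.
  by split => //; exists (map_mx (@delta R) q) => //; exists q.
rewrite -subset0 => _ [[_ [q _ <-] <-] Hq].
suff : hits (cylinder xi) W (SL_emb (repr g)) q by rewrite h.
by rewrite /hits /= E.
Qed.

Lemma SL_emb_continuous : continuous SL_emb.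
Proof.
apply/continuousP => _ [B oB <-].
apply: (@open_comp _ _ (fun M : SL (adele R) d => (M, 0 : 'rV[adele R]_d)) B) oB => M _.
pose z : 'rV[adele R]_d := 0.
apply: (@cvg_pair _ _ _ (nbhs M) (nbhs M) (nbhs z) (nbhs_filter M)
  (nbhs_filter M) (nbhs_filter z) id (fun=> z)); first exact: cvg_id.
exact: cvg_cst.
Qed.

Lemma SL_embM (M N : SL (adele R) d) : SL_emb (M * N)%g = (SL_emb M * SL_emb N)%g.
Proof. by congr MkASL; rewrite mul0mx addr0. Qed.

Lemma SL_emb_map (c : SL rat d) :
  SL_emb (SL_map (@delta R) c) = ASL_map (@delta R) (MkASL c 0).
Proof. by congr MkASL; rewrite map_mx0. Qed.

Lemma ASL_void_continuous (hd : (2 <= d)%N)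
    (mu : probability (borel (ASL_quot R d)) R) (W : set 'rV[fadele]_d) :
  ASL_invariant mu -> bounded_in W ->
  measurable (W : set (borel 'rV[fadele]_d)) ->
  continuous (fun xi : R => fine (mu (ASL_void xi W))).
Proof.
move=> inv bW mW; under eq_fun do rewrite ASL_voidE.
apply: (@void_probability_continuous R d (ASL (adele R) d) (ASL_quot R d)
  \pi_(ASL_quot R d)%qT _ _ _ _ _ _ mu hd) => //.
- exact: reprK.
- by move=> g; exact: cvg_id.
- by move=> g h /lquot_repr.
- move=> s s0; exists (lquot_mulr (scal hd s0)); split; first exact: inv.
  by move=> x; apply: lquot_repr; rewrite reprK.
Qed.

Lemma SL_void_continuous (hd : (2 <= d)%N)
    (mu : probability (borel (SL_quot R d)) R) (W : set 'rV[fadele]_d) :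
  SL_invariant mu -> bounded_in W ->
  measurable (W : set (borel 'rV[fadele]_d)) ->
  continuous (fun xi : R => fine (mu (SL_void xi W))).
Proof.
move=> inv bW mW; under eq_fun do rewrite SL_voidE.
apply: (@void_probability_continuous R d (SL (adele R) d) (SL_quot R d)
  \pi_(SL_quot R d)%qT _ _ _ _ _ _ mu hd) => //.
- exact: reprK.
- exact: SL_emb_continuous.
- by move=> g h /lquot_repr[c ->]; exists (MkASL c 0); rewrite SL_embM SL_emb_map.
- move=> s s0; exists (lquot_mulr (ASL_lin (scal hd s0))); split; first exact: inv.
  move=> x; set h := ASL_lin _.
  have [c ->] : exists c, repr (lquot_mulr h x) = (SL_map (@delta R) c * (repr x * h))%g.
    by apply: lquot_repr; rewrite reprK.
  by exists (MkASL c 0); rewrite !SL_embM SL_emb_map.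
Qed.

Lemma rV_fadele_addr_continuous (c : 'rV[fadele]_d) :
  continuous (fun x : 'rV[fadele]_d => x + c).
Proof.
move=> x; apply: (@cvg_mx _ _ _ _ (nbhs x) (nbhs_filter x)) => i j; rewrite mxE.
under eq_fun do rewrite mxE.
apply: (@fadele_cvgD _ (nbhs x)); last exact: cvg_cst.
exact: mx_entry_continuous.
Qed.

(** As a preimage under a translation, the shifted window is Borel by continuity. *)
Lemma shift_windowE (A : SL (adele R) d) W beta :
  shift_window A W beta = (fun x => x + adele_fin beta *m adele_fin A) @^-1` W.
Proof.
apply/seteqP; split => [_ [w Ww <-]|x Wx] /=; first by rewrite subrK.
by exists (x + adele_fin beta *m adele_fin A) => //; rewrite addrK.
Qed.

Lemma shift_window_bounded (A : SL (adele R) d) W beta :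
  bounded_in W -> bounded_in (shift_window A W beta).
Proof.
move=> [K cK WK]; pose c := adele_fin beta *m adele_fin A.
exists ((fun x => x + - c) @` K); last by move=> _ [w Ww <-]; exists w => //; exact: WK.
apply: continuous_compact => //; apply: continuous_subspaceT.
exact: rV_fadele_addr_continuous.
Qed.

End Quotients.

Theorem theorem10p1 (R : realType) (d : nat) (hd : (2 <= d)%N)
  (mf : {measure set (borel 'rV[fadele]_d) -> \bar R}) (hmf : haar mf)
  (muASL : probability (borel (ASL_quot R d)) R) (hASL : ASL_invariant muASL)
  (muSL : probability (borel (SL_quot R d)) R) (hSL : SL_invariant muSL)
  (A : SL (adele R) d) (W : set 'rV[fadele]_d)
  (W_bounded : bounded_in W)
  (W_borel : measurable (W : set (borel 'rV[fadele]_d)))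
  (W_boundary : mf (boundary W) = 0%E)
  (alpha : 'rV[R]_d) :
  {within [set` `]0, +oo[], continuous (F_P muASL muSL A W alpha)}.
Proof.
apply: continuous_subspaceT; rewrite /F_P.
case: pselect => [alphaQ|alphaNQ]; last exact: ASL_void_continuous.
(* The vector [beta] is independent of [xi], and the shift keeps the window bounded and Borel, so
   the linear case applies to the shifted window. *)
apply: SL_void_continuous => //; first exact: shift_window_bounded.
rewrite shift_windowE; apply: continuous_borel_measurable => //.
exact: rV_fadele_addr_continuous.
Qed.
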